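(* Let $\alpha,\beta,\mu,\nu,\tau\in\mathbb{R}$ and $x>0$ with $\mu+1/2>\alpha$ and $\nu+1/2>\beta$. Then $$W_{\alpha,\mu-i\tau}(x)\,W_{\beta,\nu+i\tau}(x)=\frac{e^{-x}x^{\mu+\nu+1}}{\Gamma(\mu+\nu-\alpha-\beta+1)}\int_0^\infty e^{-xs}s^{\mu+\nu-\alpha-\beta}(1+s)^{\nu+\mu+\beta+\alpha-1}$$ $$\times F_3\left(\tfrac12-\nu-i\tau-\beta,\ \tfrac12-\mu+i\tau-\alpha,\ \tfrac12+\mu-i\tau-\alpha,\ \tfrac12+\nu+i\tau-\beta;\ \mu+\nu-\alpha-\beta+1;\ \frac{s}{1+s},\frac{s}{1+s}\right)ds.$$
   Context: $W_{\kappa,\lambda}(x)$ is the Whittaker function of the second kind, the standard solution of $u''+\left(\frac{\kappa}{x}-\frac14+\frac{1/4-\lambda^2}{x^2}\right)u=0$ which decays like $x^{\kappa}e^{-x/2}$ as $x\to+\infty$. $F_3$ is the Appell function $$F_3(a,a',b,b';c;z_1,z_2)=\sum_{m,n=0}^\infty\frac{(a)_m(a')_n(b)_m(b')_n}{(c)_{m+n}\,m!\,n!}z_1^mz_2^n,\quad |z_1|<1,\ |z_2|<1,$$ where $(a)_n$ is the Pochhammer symbol. *)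

(* Defs.v *)
From HB Require Import structures.
From mathcomp Require Import all_boot all_order all_algebra.
From mathcomp Require Export complex.
From mathcomp Require Export all_classical all_reals all_analysis.

Set Implicit Arguments.
Unset Strict Implicit.
Unset Printing Implicit Defensive.

Import Order.TTheory GRing.Theory Num.Theory.
Import numFieldNormedType.Exports.

Local Open Scope classical_set_scope.
Local Open Scope ring_scope.

(* R[i] carries no topology compatible with the real scalars R, so limits,
   derivatives and integrals of R[i]-valued functions are taken on real and
   imaginary parts separately. *)

Definition cderivable (R : realType) (u : R -> R[i]) (x : R) : Prop :=
  derivable (fun y => complex.Re (u y)) x 1 /\
  derivable (fun y => complex.Im (u y)) x 1.

Definition cderive (R : realType) (u : R -> R[i]) (x : R) : R[i] :=
  (derive1 (fun y => complex.Re (u y)) x +i*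
   derive1 (fun y => complex.Im (u y)) x)%C.

Definition ccvg_pinfty (R : realType) (u : R -> R[i]) (l : R[i]) : Prop :=
  (complex.Re (u y) @[y --> +oo] --> complex.Re l) /\
  (complex.Im (u y) @[y --> +oo] --> complex.Im l).

Definition cintegrable (R : realType) (D : set R) (f : R -> R[i]) : Prop :=
  lebesgue_measure.-integrable D (fun t => (complex.Re (f t))%:E) /\
  lebesgue_measure.-integrable D (fun t => (complex.Im (f t))%:E).

Definition cintegral (R : realType) (D : set R) (f : R -> R[i]) : R[i] :=
  (Rintegral lebesgue_measure D (fun t => complex.Re (f t)) +i*
   Rintegral lebesgue_measure D (fun t => complex.Im (f t)))%C.

Definition cseries_sum (R : realType) (u : nat -> R[i]) : R[i] :=
  (limn (series (fun n => complex.Re (u n))) +i*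
   limn (series (fun n => complex.Im (u n))))%C.

(* Euler's integral; it converges exactly for z > 0. *)
Definition Gamma (R : realType) (z : R) : R :=
  Rintegral lebesgue_measure `]0, +oo[
    (fun t : R => t `^ (z - 1) * expR (- t)).

(* On x > 0, u solves Whittaker's equation with parameters k, l, and
   u x ~ x ^ k * e ^ (- x / 2) as x --> +oo. Every solution independent of such
   a u grows like x ^ (- k) * e ^ (x / 2), hence u is unique on x > 0. *)
Definition is_whittakerW (R : realType) (k : R) (l : R[i]) (u : R -> R[i]) :
    Prop :=
  (forall x : R, 0 < x ->
     [/\ cderivable u x, cderivable (cderive u) x &
       cderive (cderive u) x +
       ((k / x)%:C%C - 1 / 4 + (1 / 4 - l ^+ 2) / (x ^+ 2)%:C%C) * u x = 0]) /\
  ccvg_pinfty (fun x => u x / (x `^ k * expR (- x / 2))%:C%C) 1.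

(* Only the values at x > 0 are meaningful: is_whittakerW does not constrain
   the others. *)
Definition whittakerW (R : realType) (k : R) (l : R[i]) : R -> R[i] :=
  xget (fun=> 0) [set u | is_whittakerW k l u].

Definition pochhammer (R : realType) (a : R[i]) (n : nat) : R[i] :=
  \prod_(j < n) (a + j%:R).

Definition appellF3_term (R : realType) (a a' b b' c z1 z2 : R[i])
    (m n : nat) : R[i] :=
  pochhammer a m * pochhammer a' n * pochhammer b m * pochhammer b' n /
  (pochhammer c (m + n) * (m`!)%:R * (n`!)%:R) * z1 ^+ m * z2 ^+ n.

(* For |z1| < 1 and |z2| < 1 the double series converges absolutely, so the
   order of summation is immaterial. *)
Definition appellF3 (R : realType) (a a' b b' c z1 z2 : R[i]) : R[i] :=
  cseries_sum (fun m =>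
    cseries_sum (fun n => appellF3_term a a' b b' c z1 z2 m n)).

(* Main.v *)
Require Import Defs.
From mathcomp Require Import all_boot all_order all_algebra.
From mathcomp Require Import complex.
From mathcomp Require Import all_classical all_reals all_analysis.
From mathcomp Require Import measurable_realfun ring lra.

Set Implicit Arguments.
Unset Strict Implicit.
Unset Printing Implicit Defensive.

Import Order.TTheory GRing.Theory Num.Theory.
Import numFieldNormedType.Exports.

Local Open Scope classical_set_scope.
Local Open Scope ring_scope.

Import ComplexField.Normc.

(** Put [p = mu - i tau], [q = nu + i tau], [b = 1/2 + p - alpha],
    [c = 1/2 + q - beta], [a' = 1/2 - p - alpha] and [a = 1/2 - q - beta]; the
    two inequalities say that [b] and [c] have a positive real part. Then each
    Whittaker function is an Euler integral,
      [W_(k,l)(x) = e^(-x/2) x^(l+1/2) / Gamma(1/2+l-k)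
         * int_0^oo e^(-xt) t^(l-k-1/2) (1+t)^(l+k-1/2) dt],
    and the product of two such Laplace integrals is the Laplace integral of a
    convolution. After the substitution [t = s v] the convolution at [s] equals
      [s^(b+c-1) * int_0^1 v^(b-1) (1-v)^(c-1) (1+sv)^(-a') (1+s(1-v))^(-a) dv]
    ([laplace_integral_product]). With [z = s/(1+s)] one has
    [1+sv = (1+s)(1-z(1-v))] and [1+s(1-v) = (1+s)(1-zv)], so the two last
    factors are a power of [1+s] times two binomials in [z]. Expanding both and
    integrating termwise against the Beta density gives [F_3] times [B(b,c)],
    because [B(b+m,c+n)/B(b,c) = (b)_m (c)_n / (b+c)_(m+n)] ([appellF3_beta]).
    Finally [Gamma(b) Gamma(c) = Gamma(b+c) B(b,c)] collects the constants.

    The Whittaker function is given by its differential equation and its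
    behaviour at infinity, so the Euler integral has to be identified with it
    ([whittakerW_integral]). The equation follows from differentiation under the
    integral sign and one integration by parts ([laplace_integral_by_parts]);
    the behaviour at infinity is Watson's lemma at leading order
    ([laplace_integral_asymptotics]). Normalizing by [Gamma(b)] requires that it
    does not vanish ([cGamma_neq0]); by the functional equation it suffices to
    look far to the right, where the mass of [t^(r-1) e^(-t)] is so concentrated
    that the factor [t^(iy)] cannot cancel it. Uniqueness
    ([is_whittakerW_unique]) holds because the Wronskian of two recessive
    solutions is constant and must be zero.

    The complex Gamma function is the confluent integral at [x = 1] with the
    second factor trivial, so that its functional equation, and the relation
    with the Beta function, are instances of the statements about confluent
    integrals. Derivatives, integrals and limits of complex-valued functions
    are taken on real and imaginary parts. *)

(** * Complex numbers, the exponential and complex powers of reals *)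

Section ComplexBasics.
Context {R : realType}.
Implicit Types (x y z w : R[i]) (r s t : R).

Lemma ReD z w : complex.Re (z + w) = complex.Re z + complex.Re w.
Proof. by case: z; case: w. Qed.
Lemma ImD z w : complex.Im (z + w) = complex.Im z + complex.Im w.
Proof. by case: z; case: w. Qed.
Lemma ReN z : complex.Re (- z) = - complex.Re z.
Proof. by case: z. Qed.
Lemma ImN z : complex.Im (- z) = - complex.Im z.
Proof. by case: z. Qed.
Lemma ReM z w : complex.Re (z * w) =
  complex.Re z * complex.Re w - complex.Im z * complex.Im w.
Proof. by case: z; case: w. Qed.
Lemma ImM z w : complex.Im (z * w) =
  complex.Re z * complex.Im w + complex.Im z * complex.Re w.
Proof. by case: z => a b; case: w => c d /=; rewrite mulrC [d * a]mulrC addrC. Qed.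
Lemma Re_sum n (f : nat -> R[i]) :
  complex.Re (\sum_(0 <= i < n) f i) = \sum_(0 <= i < n) complex.Re (f i).
Proof. by elim: n => [|n IH]; [rewrite !big_geq|rewrite !big_nat_recr//= ReD IH]. Qed.
Lemma Im_sum n (f : nat -> R[i]) :
  complex.Im (\sum_(0 <= i < n) f i) = \sum_(0 <= i < n) complex.Im (f i).
Proof. by elim: n => [|n IH]; [rewrite !big_geq|rewrite !big_nat_recr//= ImD IH]. Qed.

Lemma realcM r s : (r * s)%:C%C = r%:C%C * s%:C%C :> R[i].
Proof. exact: rmorphM. Qed.
Lemma realcD r s : (r + s)%:C%C = r%:C%C + s%:C%C :> R[i].
Proof. exact: rmorphD. Qed.
Lemma realcN r : (- r)%:C%C = - r%:C%C :> R[i].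
Proof. exact: rmorphN. Qed.
Lemma realcV r : (r^-1)%:C%C = (r%:C%C)^-1 :> R[i].
Proof. exact: fmorphV. Qed.
Lemma realc_eq0 r : (r%:C%C == 0 :> R[i]) = (r == 0).
Proof. exact: fmorph_eq0. Qed.
Lemma realc_nat n : (n%:R)%:C%C = n%:R :> R[i].
Proof. exact: rmorph_nat. Qed.

Lemma complexP z w : complex.Re z = complex.Re w ->
  complex.Im z = complex.Im w -> z = w.
Proof. by case: z => a b; case: w => c d /= -> ->. Qed.

Lemma normc_ge0 z : 0 <= normc z :> R.
Proof. by case: z => a b; rewrite /normc sqrtr_ge0. Qed.

Lemma normc_real r : normc (r%:C%C : R[i]) = `|r|.
Proof. by rewrite /normc /= expr0n addr0 sqrtr_sqr. Qed.

Lemma Re_le_normc z : `|complex.Re z| <= normc z.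
Proof.
case: z => a b /=; rewrite -sqrtr_sqr ler_wsqrtr// lerDl; exact: sqr_ge0.
Qed.
Lemma Im_le_normc z : `|complex.Im z| <= normc z.
Proof.
case: z => a b /=; rewrite -sqrtr_sqr ler_wsqrtr// lerDr; exact: sqr_ge0.
Qed.
Lemma normc_le_ReIm z : normc z <= `|complex.Re z| + `|complex.Im z|.
Proof.
case: z => a b /=; rewrite -(ger0_norm (addr_ge0 (normr_ge0 a) (normr_ge0 b))).
rewrite -sqrtr_sqr ler_wsqrtr// sqrrD !real_normK ?num_real//.
by rewrite lerD2r lerDl mulrn_wge0// mulr_ge0.
Qed.

Lemma normcX z n : normc (z ^+ n) = normc z ^+ n.
Proof.
by elim: n => [|n IH]; [rewrite !expr0 (normc_real 1) normr1|rewrite !exprS normcM IH].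
Qed.

Definition cexp z : R[i] :=
  ((expR (complex.Re z) * cos (complex.Im z)) +i*
   (expR (complex.Re z) * sin (complex.Im z)))%C.

Lemma cexp0 : cexp 0 = 1.
Proof. by rewrite /cexp /= expR0 cos0 sin0 mulr1 mulr0. Qed.

Lemma cexpD z w : cexp (z + w) = cexp z * cexp w.
Proof.
apply: complexP; rewrite ?ReM ?ImM /cexp /= ReD ImD expRD ?cosD ?sinD; ring.
Qed.

Lemma normc_cexp z : normc (cexp z) = expR (complex.Re z).
Proof.
rewrite /cexp /normc !exprMn -mulrDr cos2Dsin2 mulr1 sqrtr_sqr ger0_norm ?expR_ge0//.
Qed.

Lemma cexp_neq0 z : cexp z != 0.
Proof.
apply/eqP => h; have := normc_cexp z; rewrite h normc0 => /eqP.
by rewrite eq_sym expR_eq0.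
Qed.

Lemma cexp_real r : cexp r%:C%C = (expR r)%:C%C.
Proof. by rewrite /cexp /= cos0 sin0 mulr1 mulr0. Qed.

(** The power of a positive real with a complex exponent, extended by zero to
    the nonpositive reals: integrals over half-lines and over the unit interval
    then become integrals over the whole line. *)
Definition cpow t (a : R[i]) : R[i] :=
  if 0 < t then cexp (a * (ln t)%:C%C) else 0.

Lemma cpow_le0 t a : t <= 0 -> cpow t a = 0.
Proof. by rewrite /cpow ltNge => ->. Qed.

Lemma cpowE t a : 0 < t -> cpow t a = cexp (a * (ln t)%:C%C).
Proof. by rewrite /cpow => ->. Qed.

Lemma cpow_neq0 t a : 0 < t -> cpow t a != 0.
Proof. by move=> t0; rewrite cpowE// cexp_neq0. Qed.

Lemma cpow1 a : cpow 1 a = 1.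
Proof. by rewrite cpowE// ln1 mulr0 cexp0. Qed.

Lemma cpow0 t : 0 < t -> cpow t 0 = 1.
Proof. by move=> t0; rewrite cpowE// mul0r cexp0. Qed.

Lemma cpowD t a b : cpow t (a + b) = cpow t a * cpow t b.
Proof.
by rewrite /cpow; case: ifPn; rewrite ?mulr0// => t0; rewrite mulrDl cexpD.
Qed.

Lemma cpow_real t r : 0 < t -> cpow t r%:C%C = (t `^ r)%:C%C.
Proof.
by move=> t0; rewrite cpowE// -realcM cexp_real /powR gt_eqF.
Qed.

Lemma cpow_powR1 t : 0 < t -> cpow t 1 = t%:C%C.
Proof. by move=> t0; rewrite -[1]/(1%:C%C) cpow_real// powRr1// ltW. Qed.

Lemma cpowD1 t a : cpow t (a + 1) = t%:C%C * cpow t a.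
Proof.
have [t0|t0] := leP t 0; first by rewrite !cpow_le0// mulr0.
by rewrite cpowD cpow_powR1// mulrC.
Qed.

Lemma cpowDn t a n : cpow t (a + n%:R) = t%:C%C ^+ n * cpow t a.
Proof.
elim: n => [|n IH]; first by rewrite addr0 expr0 mul1r.
by rewrite -natr1 addrA cpowD1 IH mulrA exprS.
Qed.

Lemma normc_cpow t a : 0 < t -> normc (cpow t a) = t `^ (complex.Re a).
Proof.
by move=> t0; rewrite cpowE// normc_cexp ReM /= mulr0 subr0 /powR gt_eqF.
Qed.

Lemma cpowM s t a : 0 < s -> cpow (s * t) a = cpow s a * cpow t a.
Proof.
move=> s0; have [t0|t0] := leP t 0.
  by rewrite [cpow t a]cpow_le0// mulr0 cpow_le0// pmulr_rle0.
by rewrite !cpowE ?mulr_gt0// lnM// realcD mulrDr cexpD.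
Qed.

Lemma cpowN t a : 0 < t -> cpow t (- a) = (cpow t a)^-1.
Proof.
move=> t0; apply: (@mulIf _ (cpow t a)); first exact: cpow_neq0.
by rewrite -cpowD addNr cpow0// mulVf// cpow_neq0.
Qed.

End ComplexBasics.

(** * Complex-valued functions of a real variable: derivatives *)

Section ComplexDerivative.
Context {R : realType}.
Implicit Types (u v : R -> R[i]) (x t : R) (a d : R[i]).

Definition is_cderive u x d :=
  is_derive x (1 : R) (fun y => complex.Re (u y)) (complex.Re d) /\
  is_derive x (1 : R) (fun y => complex.Im (u y)) (complex.Im d).

Lemma is_cderive_cst c x : is_cderive (fun=> c) x 0.
Proof. by split; exact: is_derive_cst. Qed.

Lemma is_cderive_eq u x d d' : is_cderive u x d -> d = d' -> is_cderive u x d'.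
Proof. by move=> h <-. Qed.

Lemma is_cderive_near u v x d : {near x, u =1 v} ->
  is_cderive u x d -> is_cderive v x d.
Proof.
move=> uv [h1 h2]; split; [apply: near_eq_is_derive h1|apply: near_eq_is_derive h2];
  rewrite ?oner_eq0//; near=> y; by rewrite (near uv y).
Unshelve. all: by end_near. Qed.

Lemma is_cderiveD u v x d d' : is_cderive u x d -> is_cderive v x d' ->
  is_cderive (fun y => u y + v y) x (d + d').
Proof.
move=> [h1 h2] [h3 h4]; split; rewrite ?ReD ?ImD.
  by under eq_fun do rewrite ReD; exact: is_deriveD.
by under eq_fun do rewrite ImD; exact: is_deriveD.
Qed.

Lemma is_cderiveM u v x d d' : is_cderive u x d -> is_cderive v x d' ->
  is_cderive (fun y => u y * v y) x (d * v x + u x * d').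
Proof.
move=> [h1 h2] [h3 h4]; split.
  under eq_fun do rewrite ReM.
  apply: is_derive_eq.
  rewrite ReD !ReM /GRing.scale /=; ring.
under eq_fun do rewrite ImM.
apply: is_derive_eq.
rewrite ImD !ImM /GRing.scale /=; ring.
Qed.

Lemma is_cderiveZ c u x d : is_cderive u x d ->
  is_cderive (fun y => c * u y) x (c * d).
Proof.
by move=> h; apply: is_cderive_eq (is_cderiveM (is_cderive_cst c x) h) _;
  rewrite mul0r add0r.
Qed.

Lemma is_cderiveN u x d : is_cderive u x d ->
  is_cderive (fun y => - u y) x (- d).
Proof.
move=> h; rewrite -mulN1r; under eq_fun do rewrite -mulN1r.
exact: is_cderiveZ.
Qed.

Lemma is_cderive_real (g : R -> R) x (dg : R) : is_derive x (1 : R) g dg ->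
  is_cderive (fun y => (g y)%:C%C) x dg%:C%C.
Proof. by move=> h; split => //=; exact: is_derive_cst. Qed.

Lemma is_cderiveV u x d : u x != 0 -> is_cderive u x d ->
  is_cderive (fun y => (u y)^-1) x (- d / u x ^+ 2).
Proof.
move=> u0 [h1 h2].
pose n y : R := complex.Re (u y) ^+ 2 + complex.Im (u y) ^+ 2.
pose c y : R[i] := (complex.Re (u y) -i* complex.Im (u y))%C.
pose dc : R[i] := (complex.Re d -i* complex.Im d)%C.
have nE y : (n y)%:C%C = u y * c y.
  by apply: complexP; rewrite ?ReM ?ImM /n /=; ring.
have n0 : n x != 0.
  rewrite -(realc_eq0 (n x)) nE mulf_neq0//; apply: contra u0 => /eqP[h h'].
  by apply/eqP/complexP => //; apply/eqP; rewrite -oppr_eq0 h'.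
have dn : is_derive x (1 : R) n
    (2 * (complex.Re (u x) * complex.Re d + complex.Im (u x) * complex.Im d)).
  by apply: is_derive_eq; rewrite /GRing.scale /=; ring.
have dc' : is_cderive c x dc by split => //=; exact: is_deriveN.
have uE : (fun y => (u y)^-1) = fun y => ((n y)^-1)%:C%C * c y.
  apply/funext => y; have [uy0|uy0] := eqVneq (u y) 0.
    by rewrite /n /c uy0 invr0 /= expr0n /= addr0 invr0 mul0r.
  have c0 : c y != 0.
    apply: contra uy0 => /eqP[h h'].
    by apply/eqP/complexP => //; apply/eqP; rewrite -oppr_eq0 h'.
  by rewrite realcV nE; field; rewrite c0 uy0.
have dV : is_derive x (1 : R) (fun y => (n y)^-1)
    (- (2 * (complex.Re (u x) * complex.Re d + complex.Im (u x) * complex.Im d)) / n x ^+ 2).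
  by apply: is_derive_eq (is_deriveV n0 dn) _; rewrite /GRing.scale /=; field.
rewrite uE; apply: is_cderive_eq (is_cderiveM (is_cderive_real dV) dc') _.
have c0 : c x != 0.
  by apply: contra n0 => /eqP cx0; rewrite -realc_eq0 nE cx0 mulr0.
have dnE : (2 * (complex.Re (u x) * complex.Re d + complex.Im (u x) * complex.Im d))%:C%C
    = d * c x + u x * dc.
  by apply: complexP; rewrite ?ReD ?ImD ?ReM ?ImM /=; ring.
rewrite realcM realcN dnE !realcV expr2 realcM !nE; field.
by rewrite c0 u0.
Qed.

Lemma is_cderive_cexp u x d : is_cderive u x d ->
  is_cderive (fun y => cexp (u y)) x (d * cexp (u x)).
Proof.
move=> [h1 h2].
have he : is_derive x (1 : R) (fun y => expR (complex.Re (u y)))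
    (complex.Re d * expR (complex.Re (u x))).
  by apply: is_derive_eq (is_derive1_comp (f := expR) _ _) _; rewrite mulrC.
have hc : is_derive x (1 : R) (fun y => cos (complex.Im (u y)))
    (complex.Im d * - sin (complex.Im (u x))).
  by apply: is_derive_eq (is_derive1_comp (f := cos) _ _) _; rewrite mulrC.
have hs : is_derive x (1 : R) (fun y => sin (complex.Im (u y)))
    (complex.Im d * cos (complex.Im (u x))).
  by apply: is_derive_eq (is_derive1_comp (f := sin) _ _) _; rewrite mulrC.
split; rewrite /cexp /=.
  by apply: is_derive_eq; rewrite ReM /GRing.scale /=; ring.
by apply: is_derive_eq; rewrite ImM /GRing.scale /=; ring.
Qed.

Lemma is_cderive_cpow t a : 0 < t ->
  is_cderive (fun y => cpow y a) t (a * cpow t (a - 1)).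
Proof.
move=> t0; apply: (@is_cderive_near (fun y => cexp (a * (ln y)%:C%C))).
  near=> y; rewrite cpowE//; near: y; exact: lt_nbhsr.
have h := is_cderive_cexp (is_cderiveZ a (is_cderive_real (is_derive1_ln t0))).
apply: is_cderive_eq h _.
rewrite -mulrA cpowD cpowN// cpow_powR1// -cpowE// realcV; congr (_ * _).
by rewrite mulrC.
Unshelve. all: by end_near. Qed.

Lemma is_cderive_cderivable u x d : is_cderive u x d -> cderivable u x.
Proof. by move=> [h1 h2]; split; [exact: (@ex_derive _ _ _ _ _ _ _ h1)|exact: (@ex_derive _ _ _ _ _ _ _ h2)]. Qed.

Lemma is_cderiveE u x d : is_cderive u x d -> cderive u x = d.
Proof.
move=> [h1 h2]; rewrite /cderive !derive1E.
by rewrite (derive_val (is_derive := h1)) (derive_val (is_derive := h2)); case: d {h1 h2}.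
Qed.

Lemma cderivableP u x : cderivable u x -> is_cderive u x (cderive u x).
Proof.
by move=> [h1 h2]; rewrite /is_cderive /cderive /= !derive1E;
  split; exact: derivableP.
Qed.

Lemma is_cderive_continuous u x d : is_cderive u x d ->
  {for x, continuous (fun y => complex.Re (u y))} /\
  {for x, continuous (fun y => complex.Im (u y))}.
Proof.
move=> /is_cderive_cderivable [h1 h2].
split; apply: differentiable_continuous; apply/derivable1_diffP.
  exact: h1.
exact: h2.
Qed.

End ComplexDerivative.

(** * Lebesgue integrals over the real line *)

Section RealIntegration.
Context {R : realType}.
Notation mu := (@lebesgue_measure R).
Implicit Types (f g : R -> R).

Definition Rintegrable f := mu.-integrable setT (EFin \o f).

Lemma Rintegrable_measurable f : Rintegrable f -> measurable_fun (setT : set (measurableTypeR R)) f.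
Proof. by move=> /measurable_int /measurable_EFinP. Qed.

Lemma Rintegrable_dominated f g : measurable_fun (setT : set (measurableTypeR R)) f ->
  (forall t, `|f t| <= g t) -> Rintegrable g -> Rintegrable f.
Proof.
move=> mf fg ig; apply: le_integrable ig => //; first exact/measurable_EFinP.
by move=> t _; rewrite lee_fin (le_trans (fg t))// ler_norm.
Qed.

Lemma RintegrableZ k f : Rintegrable f -> Rintegrable (fun t => k * f t).
Proof.
move=> i; have := integrableZl measurableT k i.
by apply: eq_integrable => //.
Qed.

Lemma RintegrableD f g : Rintegrable f -> Rintegrable g ->
  Rintegrable (fun t => f t + g t).
Proof.
move=> i j; have := integrableD measurableT i j.
by apply: eq_integrable => //.
Qed.

Lemma Rintegrable_norm f : Rintegrable f -> Rintegrable (fun t => `|f t|).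
Proof. by move=> i; apply: integrable_norm. Qed.

(** An instance of [dominated_convergence] without extended reals and without
    exceptional sets. *)
Lemma Rdominated_convergence (f_ : nat -> R -> R) f g :
  (forall n, measurable_fun (setT : set (measurableTypeR R)) (f_ n)) ->
  (forall t, f_ n t @[n --> \oo] --> f t) ->
  Rintegrable g -> (forall n t, `|f_ n t| <= g t) ->
  Rintegrable f /\
  Rintegral mu setT (f_ n) @[n --> \oo] --> Rintegral mu setT f.
Proof.
move=> mf cf ig fg.
have mf' : measurable_fun (setT : set (measurableTypeR R)) f.
  apply: (@measurable_fun_cvg _ _ _ _ f_) => // t _; exact: cf.
have [] := @dominated_convergence _ _ R mu setT measurableT
  (fun n t => (f_ n t)%:E) (fun t => (f t)%:E) (fun t => (g t)%:E).
- by move=> n; apply/measurable_EFinP; exact: mf.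
- exact/measurable_EFinP.
- by apply: aeW => t _; apply: cvg_EFin; [exact: nearW|exact: cf].
- exact: ig.
- by apply: aeW => t n _; rewrite lee_fin.
move=> i _ c; split => //.
rewrite /Rintegral; apply: fine_cvg.
rewrite fineK//; exact: integrable_fin_num.
Qed.

(* The affine maps are typed as maps of the measurable space of reals, so that
   they can be pushed forward along. *)
Let phi (c s : R) (v : measurableTypeR R) : measurableTypeR R := c + s * v.

Let measurable_phi c s : measurable_fun setT (phi c s).
Proof. by apply: measurable_funD => //; exact: measurable_funM. Qed.

(** Up to the factor [|s|], both measures give an interval its length, and
    intervals determine the Lebesgue measure. *)
Lemma lebesgue_measure_affine (c s : R) : s != 0 ->
  forall A : set (measurableTypeR R), measurable A ->
  mu A = (`|s|%:E * pushforward mu (phi c s) A)%E.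
Proof.
move=> s0 A mA.
have s0' : 0 <= `|s| by [].
suff -> : mu A = mscale (NngNum s0') (pushforward mu (phi c s)) A by [].
move=> mphi; apply: lebesgue_measure_unique mA => _ [[a b]] _ <-.
rewrite /= /mscale lebesgue_measure_itv /= /pushforward /phi /=.
have [s_gt0|s_lt0] : 0 < s \/ s < 0.
  by move: s0; rewrite neq_lt => /orP[]; [right|left].
- have -> : (fun v : R => c + s * v) @^-1` `]a, b] = `](a - c) / s, (b - c) / s]%classic.
    apply/seteqP; split => v /=; rewrite !in_itv/= ltr_pdivrMr// ler_pdivlMr//;
      rewrite ltrBlDl lerBrDl mulrC//.
  rewrite lebesgue_measure_itv /= !lte_fin ltr_pM2r ?invr_gt0// ltrD2r.
  case: ifPn => ab; last by rewrite mule0.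
  rewrite -EFinB -EFinM gtr0_norm//; congr (_%:E); field.
  by rewrite gt_eqF.
- have -> : (fun v : R => c + s * v) @^-1` `]a, b] = `[(b - c) / s, (a - c) / s[%classic.
    apply/seteqP; split => v /=; rewrite !in_itv/= ltr_ndivlMr// ler_ndivrMr//;
      rewrite ltrBlDl lerBrDl [v * s]mulrC andbC//.
  rewrite lebesgue_measure_itv /= !lte_fin ltr_nM2r ?invr_lt0// ltrD2r.
  case: ifPn => ab; last by rewrite mule0.
  rewrite -EFinB -EFinM ltr0_norm//; congr (_%:E); field.
  by rewrite lt_eqF.
Qed.

Lemma ge0_integral_affine (c s : R) (f : measurableTypeR R -> \bar R) : s != 0 ->
  measurable_fun (setT : set (measurableTypeR R)) f -> (forall t, (0 <= f t)%E) ->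
  (\int[mu]_t f t = `|s|%:E * \int[mu]_v f (c + s * v)%R)%E.
Proof.
move=> s0 mf f0.
have s0' : 0 <= `|s| by [].
rewrite (eq_measure_integral (mscale (NngNum s0')
  (pushforward mu (phi c s)))); last first.
  by move=> A mA _; exact: lebesgue_measure_affine.
rewrite ge0_integral_mscale//= ge0_integral_pushforward//.
Qed.

Lemma Rintegrable_affine (c s : R) f : s != 0 ->
  Rintegrable f -> Rintegrable (fun v => f (c + s * v)).
Proof.
move=> s0 /integrableP[mf foo].
apply/integrableP; split; first exact: (measurableT_comp mf (measurable_phi c s)).
move: foo; rewrite (ge0_integral_affine c s0)//; last exact: measurableT_comp.
set I := (\int[mu]_v _)%E.
case: (eqVneq I +oo%E) => [->|]; last by rewrite -ltey.
by rewrite gt0_muley ?lte_fin ?normr_gt0.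
Qed.

Lemma Rintegral_affine (c s : R) f : s != 0 -> Rintegrable f ->
  Rintegral mu setT f = `|s| * Rintegral mu setT (fun v => f (c + s * v)).
Proof.
move=> s0 i; have i' := Rintegrable_affine c s0 i.
rewrite /Rintegral -[X in X * _]/(fine (`|s|%:E)) -fineM//; last first.
  exact: (integrable_fin_num measurableT i').
congr fine.
rewrite integralE [in RHS]integralE muleBr//; last first.
  apply: fin_num_adde_defl; rewrite fin_numN.
  exact: (integrable_neg_fin_num measurableT i').
congr (_ - _)%E.
  rewrite (ge0_integral_affine c s0)//.
    by congr (_ * _)%E; apply: eq_integral => v _; rewrite /= !unlock.
  by apply: measurable_funepos; apply/measurable_EFinP; exact: Rintegrable_measurable.
rewrite (ge0_integral_affine c s0)//.
  by congr (_ * _)%E; apply: eq_integral => v _; rewrite /= !unlock.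
by apply: measurable_funeneg; apply/measurable_EFinP; exact: Rintegrable_measurable.
Qed.

End RealIntegration.

(** * Lebesgue integrals of complex-valued functions *)

Section ComplexIntegration.
Context {R : realType}.
Implicit Types (f g : R -> R[i]).

Definition cmeasurable d (T : measurableType d) (f : T -> R[i]) :=
  measurable_fun setT (fun t => complex.Re (f t)) /\
  measurable_fun setT (fun t => complex.Im (f t)).

Section measurability.
Context d (T : measurableType d).
Implicit Types (u v : T -> R[i]).

Lemma cmeasurable_cst (c : R[i]) : cmeasurable (fun _ : T => c).
Proof. by split; exact: measurable_cst. Qed.

Lemma cmeasurableD u v : cmeasurable u -> cmeasurable v ->
  cmeasurable (fun t => u t + v t).
Proof.
move=> [h1 h2] [h3 h4]; split.
  by under eq_fun do rewrite ReD; exact: measurable_funD.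
by under eq_fun do rewrite ImD; exact: measurable_funD.
Qed.

Lemma cmeasurableM u v : cmeasurable u -> cmeasurable v ->
  cmeasurable (fun t => u t * v t).
Proof.
move=> [h1 h2] [h3 h4]; split.
  by under eq_fun do rewrite ReM; apply: measurable_funB; exact: measurable_funM.
by under eq_fun do rewrite ImM; apply: measurable_funD; exact: measurable_funM.
Qed.

Lemma cmeasurableX u n : cmeasurable u -> cmeasurable (fun t => u t ^+ n).
Proof.
move=> h; elim: n => [|n IH].
  by under eq_fun do rewrite expr0; exact: cmeasurable_cst.
by under eq_fun do rewrite exprS; exact: cmeasurableM.
Qed.

Lemma cmeasurable_sum n (u : nat -> T -> R[i]) :
  (forall k, cmeasurable (u k)) ->
  cmeasurable (fun t => \sum_(0 <= k < n) u k t).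
Proof.
move=> h; elim: n => [|n IH].
  by under eq_fun do rewrite big_geq//; exact: cmeasurable_cst.
by under eq_fun do rewrite big_nat_recr//=; exact: cmeasurableD.
Qed.

Lemma cmeasurable_real (g : T -> R) : measurable_fun setT g ->
  cmeasurable (fun t => (g t)%:C%C).
Proof. by move=> h; split => //=; exact: measurable_cst. Qed.

Lemma cmeasurable_cexp u : cmeasurable u -> cmeasurable (fun t => cexp (u t)).
Proof.
move=> [h1 h2]; split => /=; apply: measurable_funM.
- exact: measurableT_comp (@measurable_expR R) h1.
- apply: measurableT_comp h2.
  by apply: continuous_measurable_fun; exact: continuous_cos.
- exact: measurableT_comp (@measurable_expR R) h1.
- apply: measurableT_comp h2.
  by apply: continuous_measurable_fun; exact: continuous_sin.
Qed.

Lemma cmeasurable_cpow (g : T -> R) a : measurable_fun setT g ->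
  cmeasurable (fun t => cpow (g t) a).
Proof.
move=> mg.
have -> : (fun t => cpow (g t) a) =
    fun t => ((0 < g t)%R%:R : R)%:C%C * cexp (a * (ln (g t))%:C%C).
  by apply/funext => t; rewrite /cpow; case: ifPn => _; rewrite ?mul1r ?mul0r.
apply: cmeasurableM.
  apply: cmeasurable_real.
  have : measurable_fun setT (fun t => 0 < g t).
    by apply: measurable_fun_ltr => //; exact: measurable_cst.
  by move=> h; apply: (measurableT_comp (f := fun b : bool => (b%:R : R))).
apply: cmeasurable_cexp; apply: cmeasurableM; first exact: cmeasurable_cst.
apply: cmeasurable_real; exact: measurableT_comp (@measurable_ln R) mg.
Qed.

End measurability.

Lemma cmeasurable_comp d1 d2 (T1 : measurableType d1) (T2 : measurableType d2)
  (u : T2 -> R[i]) (g : T1 -> T2) : cmeasurable u -> measurable_fun setT g ->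
  cmeasurable (fun t => u (g t)).
Proof.
by move=> [h1 h2] mg; split; [exact: (measurableT_comp h1 mg)|exact: (measurableT_comp h2 mg)].
Qed.

Definition cintegrableT f := cintegrable setT f.
Definition cintegralT f : R[i] := cintegral setT f.

Lemma cintegrable_dominated f (g : R -> R) :
  cmeasurable (f : measurableTypeR R -> R[i]) ->
  (forall t, normc (f t) <= g t) -> Rintegrable g -> cintegrableT f.
Proof.
move=> [m1 m2] fg ig; split; apply: Rintegrable_dominated ig => // t.
  exact: le_trans (Re_le_normc _) (fg t).
exact: le_trans (Im_le_normc _) (fg t).
Qed.

Lemma cintegrable_measurable f : cintegrableT f ->
  cmeasurable (f : measurableTypeR R -> R[i]).
Proof. by move=> [h1 h2]; split; exact: Rintegrable_measurable. Qed.

Lemma cintegrableD f g : cintegrableT f -> cintegrableT g ->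
  cintegrableT (fun t => f t + g t).
Proof.
move=> [h1 h2] [h3 h4]; split.
  by under eq_fun do rewrite ReD; exact: RintegrableD h1 h3.
by under eq_fun do rewrite ImD; exact: RintegrableD h2 h4.
Qed.

Lemma cintegrableZ c f : cintegrableT f -> cintegrableT (fun t => c * f t).
Proof.
move=> [h1 h2]; split.
  under eq_fun do rewrite ReM -mulNr.
  exact: RintegrableD (RintegrableZ _ h1) (RintegrableZ _ h2).
under eq_fun do rewrite ImM.
exact: RintegrableD (RintegrableZ _ h2) (RintegrableZ _ h1).
Qed.

Lemma cintegralD f g : cintegrableT f -> cintegrableT g ->
  cintegralT (fun t => f t + g t) = cintegralT f + cintegralT g.
Proof.
move=> [h1 h2] [h3 h4]; apply: complexP; rewrite ?ReD ?ImD /=.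
  by rewrite -RintegralD//; apply: eq_Rintegral => t _; rewrite ReD.
by rewrite -RintegralD//; apply: eq_Rintegral => t _; rewrite ImD.
Qed.

Lemma cintegralZ c f : cintegrableT f ->
  cintegralT (fun t => c * f t) = c * cintegralT f.
Proof.
move=> [h1 h2]; apply: complexP; rewrite ?ReM ?ImM /=.
  under eq_Rintegral do rewrite ReM -mulNr.
  rewrite RintegralD//; [|exact: RintegrableZ|exact: RintegrableZ].
  by rewrite !RintegralZl// mulNr.
under eq_Rintegral do rewrite ImM.
rewrite RintegralD//; [|exact: RintegrableZ|exact: RintegrableZ].
by rewrite !RintegralZl.
Qed.

Lemma cintegral0 : cintegralT (fun=> 0) = 0.
Proof. by apply: complexP; rewrite /= Rintegral_cst// mul0r. Qed.

Lemma cintegralZr c f : cintegrableT f ->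
  cintegralT (fun t => f t * c) = cintegralT f * c.
Proof.
move=> h; rewrite mulrC -cintegralZ//; congr cintegralT.
by apply/funext => t; rewrite mulrC.
Qed.

Lemma cintegrable_affine (c s : R) f : s != 0 -> cintegrableT f ->
  cintegrableT (fun v => f (c + s * v)).
Proof.
by move=> s0 [h1 h2]; split; [exact: (Rintegrable_affine c s0 h1)|exact: (Rintegrable_affine c s0 h2)].
Qed.

Lemma cintegral_affine (c s : R) f : s != 0 -> cintegrableT f ->
  cintegralT f = `|s|%:C%C * cintegralT (fun v => f (c + s * v)).
Proof.
move=> s0 [h1 h2]; apply: complexP; rewrite ?ReM ?ImM /= mul0r ?subr0 ?addr0.
  exact: Rintegral_affine.
exact: Rintegral_affine.
Qed.

(** Componentwise convergence, the only notion of limit needed for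
    complex-valued families. *)
Definition ccvg (u : nat -> R[i]) (l : R[i]) :=
  complex.Re (u n) @[n --> \oo] --> complex.Re l /\
  complex.Im (u n) @[n --> \oo] --> complex.Im l.

Lemma ccvg_cst c : ccvg (fun=> c) c.
Proof. by split; exact: cvg_cst. Qed.

Lemma ccvgM u v a b : ccvg u a -> ccvg v b -> ccvg (fun n => u n * v n) (a * b).
Proof.
move=> [h1 h2] [h3 h4]; split.
  rewrite ReM; under eq_fun do rewrite ReM.
  by apply: cvgB; apply: cvgM.
rewrite ImM; under eq_fun do rewrite ImM.
by apply: cvgD; apply: cvgM.
Qed.

Lemma cdominated_convergence (f_ : nat -> R -> R[i]) f (g : R -> R) :
  (forall n, cmeasurable (f_ n : measurableTypeR R -> R[i])) ->
  (forall t, ccvg (fun n => f_ n t) (f t)) ->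
  Rintegrable g -> (forall n t, normc (f_ n t) <= g t) ->
  cintegrableT f /\ ccvg (fun n => cintegralT (f_ n)) (cintegralT f).
Proof.
move=> mf cf ig fg.
have [i1 c1] := Rdominated_convergence (fun n => (mf n).1) (fun t => (cf t).1) ig
  (fun n t => le_trans (Re_le_normc _) (fg n t)).
have [i2 c2] := Rdominated_convergence (fun n => (mf n).2) (fun t => (cf t).2) ig
  (fun n t => le_trans (Im_le_normc _) (fg n t)).
by split; split.
Qed.

End ComplexIntegration.

(** * Integral of a convolution *)

Section Fubini.
Context {R : realType}.
Notation mu := (@lebesgue_measure R).
Notation mR := (measurableTypeR R).

(** Convolution type kernels are dominated by [g t * h (s - t)], whose
    iterated integral is the product of the two integrals. *)
Lemma Rfubini_convolution (F : mR * mR -> R) (g h : R -> R) :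
  measurable_fun setT F ->
  (forall t s, `|F (t, s)| <= g t * h (s - t)) ->
  (forall t, 0 <= g t) -> (forall t, 0 <= h t) ->
  Rintegrable g -> Rintegrable h ->
  (forall t, Rintegrable (fun s => F (t, s))) /\
  Rintegrable (fun s => Rintegral mu setT (fun t => F (t, s))) /\
  Rintegral mu setT (fun t => Rintegral mu setT (fun s => F (t, s))) =
  Rintegral mu setT (fun s => Rintegral mu setT (fun t => F (t, s))).
Proof.
move=> mF Fgh g0 h0 ig ih.
have ish t : Rintegrable (fun s => h (s - t)).
  have := Rintegrable_affine (- t) (oner_neq0 R) ih.
  by under eq_fun do rewrite mul1r addrC.
have ishE t : Rintegral mu setT (fun s => h (s - t)) = Rintegral mu setT h.
  rewrite (Rintegral_affine (- t) (oner_neq0 R) ih) normr1 mul1r.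
  by apply: eq_Rintegral => s _; rewrite mul1r addrC.
have iF1 t : Rintegrable (fun s => F (t, s)).
  apply: Rintegrable_dominated (Fgh t) _; last exact: RintegrableZ.
  exact: (measurableT_comp mF (pair1_measurable t)).
have mEF : measurable_fun setT (EFin \o F) by exact/measurable_EFinP.
have iF : (mu \x mu)%E.-integrable setT (EFin \o F).
  apply/(integrable12ltyP _ _ mEF).
  pose C := Rintegral mu setT h.
  have C0 : 0 <= C by exact: Rintegral_ge0.
  apply: (@le_lt_trans _ _ (\int[mu]_t (C * g t)%:E)%E); last first.
    by apply: integrable_lty => //; exact: RintegrableZ.
  apply: ge0_le_integral => //.
  - by move=> t _; exact: integral_ge0.
  - apply: (measurable_fun_fubini_tonelli_F (abse \o (EFin \o F))) => //=.
    exact: measurableT_comp.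
  - by apply/measurable_EFinP/measurable_funM => //; exact: Rintegrable_measurable.
  move=> t _.
  have -> : ((C * g t)%:E = \int[mu]_s (g t * h (s - t))%:E)%E.
    rewrite mulrC /C -(ishE t) -(RintegralZl _ measurableT (ish t)).
    rewrite /Rintegral [LHS]fineK//.
    by apply: integrable_fin_num => //; exact: RintegrableZ.
  apply: ge0_le_integral => //.
  - by apply: measurableT_comp => //; apply/measurable_EFinP; exact: Rintegrable_measurable.
  - by apply/measurable_EFinP; apply: Rintegrable_measurable; exact: RintegrableZ.
  - by move=> s _; rewrite lee_fin.
split; first exact: iF1.
have aeG := ae_integrable2 iF.
have GE : ae_eq mu setT (fun s => \int[mu]_t (F (t, s))%:E)%E
   (EFin \o (fun s => Rintegral mu setT (fun t => F (t, s)))).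
  apply: filterS aeG => s Fs _ /=; rewrite /Rintegral fineK//.
  exact: integrable_fin_num.
pose G s := (\int[mu]_t (F (t, s))%:E)%E.
have mG : measurable_fun setT G := measurable_fubini_G iF.
have mFs s : measurable_fun setT (fun t => F (t, s)).
  exact: (measurableT_comp mF (pair2_measurable s)).
have iG : mu.-integrable setT G.
  apply/integrableP; split => //.
  apply: le_lt_trans ((integrable21ltyP _ _ mEF).1 iF).
  apply: ge0_le_integral => //.
  - exact: measurableT_comp.
  - apply: (measurable_fun_fubini_tonelli_G (abse \o (EFin \o F))) => //=.
    exact: measurableT_comp.
  - by move=> s _; apply: le_abse_integral => //; exact/measurable_EFinP.
have mRG : measurable_fun setT (fun s => Rintegral mu setT (fun t => F (t, s))).
  exact: (measurableT_comp (@fine_measurable R setT measurableT) mG).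
split.
  (* Where the inner integral is infinite its real value is zero. *)
  apply: le_integrable iG => //; first exact/measurable_EFinP.
  move=> s _; rewrite /= /Rintegral -/(G s).
  by case: (G s) => [r| |] //=; rewrite normr0 ?leey.
rewrite /Rintegral; congr fine.
transitivity (\int[mu]_s G s)%E; last first.
  by apply: ae_eq_integral => //; exact/measurable_EFinP.
rewrite -(Fubini iF); apply: eq_integral => t _.
by rewrite fineK//; exact: (integrable_fin_num measurableT (iF1 t)).
Qed.

(** The inner integral over [s] is translation invariant, so Fubini's theorem
    turns the product of two integrals into the integral of the convolution. *)
Lemma cfubini_convolution (f g : R -> R[i]) (p q : R -> R) :
  cmeasurable (f : mR -> R[i]) -> cmeasurable (g : mR -> R[i]) ->
  (forall t, normc (f t) <= p t) -> (forall t, normc (g t) <= q t) ->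
  Rintegrable p -> Rintegrable q ->
  cintegrableT (fun s => cintegralT (fun t => f t * g (s - t))) /\
  cintegralT f * cintegralT g =
  cintegralT (fun s => cintegralT (fun t => f t * g (s - t))).
Proof.
move=> mf mg fp gq ip iq.
have if_ := cintegrable_dominated mf fp ip.
have ig := cintegrable_dominated mg gq iq.
have p0 t : 0 <= p t := le_trans (normc_ge0 _) (fp t).
have q0 t : 0 <= q t := le_trans (normc_ge0 _) (gq t).
pose F (ts : mR * mR) := f ts.1 * g (ts.2 - ts.1).
have mF : cmeasurable F.
  apply: cmeasurableM; first exact: (cmeasurable_comp mf measurable_fst).
  apply: (cmeasurable_comp mg); apply: measurable_funB.
    exact: measurable_snd.
  exact: measurable_fst.
have FE t s : normc (F (t, s)) <= p t * q (s - t).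
  by rewrite /F /= normcM ler_pM ?normc_ge0.
have [i1 [i2 i3]] := Rfubini_convolution mF.1
  (fun t s => le_trans (Re_le_normc _) (FE t s)) p0 q0 ip iq.
have [j1 [j2 j3]] := Rfubini_convolution mF.2
  (fun t s => le_trans (Im_le_normc _) (FE t s)) p0 q0 ip iq.
split; first exact: (conj i2 j2).
transitivity (cintegralT (fun t => cintegralT (fun s => F (t, s)))); last first.
  by apply: complexP; [exact: i3|exact: j3].
rewrite -(cintegralZr _ if_); congr cintegralT; apply/funext => t.
have igt : cintegrableT (fun s => g (s - t)).
  have := cintegrable_affine (- t) (oner_neq0 R) ig.
  by under eq_fun do rewrite mul1r addrC.
transitivity (f t * cintegralT (fun s => g (s - t))); last first.
  exact: esym (cintegralZ (f t) igt).
congr (_ * _).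
rewrite (cintegral_affine (- t) (oner_neq0 R) ig) normr1 mul1r.
by congr cintegralT; apply/funext => s; rewrite mul1r addrC.
Qed.

End Fubini.

(** * Exact derivatives on the half-line *)

Section HalfLineFTC.
Context {R : realType}.
Notation mu := (@lebesgue_measure R).
Variables (f F : R -> R).
Hypothesis derF : forall t : R, 0 < t -> is_derive t (1 : R) F (f t).
Hypothesis cf : forall t : R, 0 < t -> {for t, continuous f}.

Lemma segment_FTC a b : 0 < a -> a < b ->
  (\int[mu]_(t in `[a, b]) (f t)%:E = (F b)%:E - (F a)%:E)%E.
Proof.
move=> a0 ab; apply: continuous_FTC2 => //.
- apply: continuous_in_subspaceT => t; rewrite inE /= in_itv /= => /andP[at_ _].
  by apply: cf; exact: lt_le_trans at_.
- have cF (t : R) : 0 < t -> {for t, continuous F}.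
    move=> /derF h; apply: differentiable_continuous; apply/derivable1_diffP.
    exact: (@ex_derive _ _ _ _ _ _ _ h).
  split.
  + move=> t; rewrite in_itv /= => /andP[at_ _].
    exact: (@ex_derive _ _ _ _ _ _ _ (derF (lt_trans a0 at_))).
  + exact/cvg_at_right_filter/cF.
  + exact/cvg_at_left_filter/cF/(lt_trans a0).
- move=> t; rewrite in_itv /= => /andP[at_ _].
  rewrite derive1E.
  exact: (derive_val (is_derive := derF (lt_trans a0 at_))).
Qed.

Hypothesis mf : measurable_fun (setT : set (measurableTypeR R)) f.
Hypothesis f_le0 : forall t, t <= 0 -> f t = 0.

(* Compact intervals exhausting the half-line: [F] and [f] may be singular at
   the origin. Starting at 2 keeps the endpoints distinct. *)
Let E n : set R := `[n.+2%:R^-1, n.+2%:R]%classic.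

Let E_FTC n :
  (\int[mu]_(t in E n) (f t)%:E = (F n.+2%:R)%:E - (F n.+2%:R^-1)%:E)%E.
Proof.
apply: segment_FTC; first by rewrite invr_gt0.
by apply: (@lt_trans _ _ 1); rewrite ?invf_lt1 ?ltr1n.
Qed.

Let E_near t : 0 < t -> \forall n \near \oo, E n t.
Proof.
move=> t0; near=> n; rewrite /E /= in_itv /=; apply/andP; split.
  rewrite invf_ple ?posrE//.
  apply: le_trans (_ : n%:R <= _); last by rewrite ler_nat; do 2 apply: leqW.
  near: n; exact: nbhs_infty_ger.
apply: le_trans (_ : n%:R <= _); last by rewrite ler_nat; do 2 apply: leqW.
near: n; exact: nbhs_infty_ger.
Unshelve. all: by end_near. Qed.

Let fE n t : R := \1_(E n) t * f t.

Let mfE n : measurable_fun (setT : set (measurableTypeR R)) (fE n).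
Proof.
by apply: measurable_funM => //; apply/measurable_indicP; exact: measurable_itv.
Qed.

Let fE_cvg t : fE n t @[n --> \oo] --> f t.
Proof.
have [t0|t0] := leP t 0.
  rewrite f_le0//; under eq_fun do rewrite /fE f_le0// mulr0.
  exact: cvg_cst.
apply: cvg_near_cst; near=> n; rewrite /fE indicE mem_set ?mul1r//.
near: n; exact: E_near.
Unshelve. all: by end_near. Qed.

Let int_fE n : (\int[mu]_t (fE n t)%:E = (F n.+2%:R)%:E - (F n.+2%:R^-1)%:E)%E.
Proof.
rewrite -E_FTC [RHS]integral_mkcond; apply: eq_integral => t _.
by rewrite patchE /fE indicE; case: ifPn => h; rewrite ?mul1r ?mul0r.
Qed.

(** By monotone convergence, the integral is the limit of increments of [F],
    which are bounded by [2 C]. *)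
Lemma ge0_bounded_primitive_integrable C : (forall t, 0 <= f t) ->
  (forall t, 0 < t -> `|F t| <= C) -> Rintegrable f.
Proof.
move=> f0 FC; apply/integrableP; split; first exact/measurable_EFinP.
apply: (@le_lt_trans _ _ (C + C)%:E); last exact: ltry.
under eq_integral do rewrite /= ger0_norm//.
have -> : (\int[mu]_t (f t)%:E = \int[mu]_(t in \bigcup_n E n) (f t)%:E)%E.
  rewrite [RHS]integral_mkcond; apply: eq_integral => t _; rewrite patchE.
  case: ifPn => // /negP h; have [t0|t0] := leP t 0; first by rewrite f_le0.
  exfalso; apply: h; rewrite inE; have [n _ En] := E_near t0.
  by exists n => //; exact: (En n (leqnn n)).
have ndE : nondecreasing_seq E.
  move=> m n mn; apply/subsetPset => t; rewrite /E /= !in_itv /= => /andP[h1 h2].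
  apply/andP; split.
    by apply: le_trans h1; rewrite lef_pV2 ?posrE// ler_nat !ltnS.
  by apply: (le_trans h2); rewrite ler_nat !ltnS.
have cv := ge0_nondecreasing_set_cvg_integral (mu := mu) ndE
  (fun i => measurable_itv _) (fun i => measurable_funTS ((measurable_EFinP _ _).2 mf))
  (fun i x _ => f0 x : (0 <= (f x)%:E)%E).
rewrite -(cvg_lim _ cv)//; apply: lime_le; first by apply/cvg_ex; exists (\int[mu]_(t in \bigcup_n E n) (f t)%:E)%E.
apply: nearW => n; rewrite E_FTC -EFinB lee_fin.
apply: le_trans (ler_norm _) _; apply: le_trans (ler_normB _ _) _.
by apply: lerD; apply: FC; rewrite ?invr_gt0.
Qed.

Lemma Rintegral_exact_derivative : Rintegrable f ->
  F n.+2%:R @[n --> \oo] --> 0 -> F n.+2%:R^-1 @[n --> \oo] --> 0 ->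
  Rintegral mu setT f = 0.
Proof.
move=> fi Fy F0.
have fEf n t : `|fE n t| <= `|f t|.
  by rewrite /fE normrM indicE; case: (t \in E n); rewrite ?normr1 ?mul1r ?normr0 ?mul0r.
have [_] := Rdominated_convergence mfE fE_cvg (Rintegrable_norm fi) fEf.
have -> : (fun n => Rintegral mu setT (fE n)) =
    fun n => F n.+2%:R - F n.+2%:R^-1.
  by apply/funext => n; rewrite /Rintegral int_fE.
move=> cI; apply: (cvg_unique _ cI) => //.
by rewrite -(subr0 (0 : R)); apply: cvgB.
Qed.

End HalfLineFTC.

Section ComplexFTC.
Context {R : realType}.

Lemma ccvg_norm0 (u : nat -> R[i]) :
  normc (u n) @[n --> \oo] --> (0 : R) -> ccvg u 0.
Proof.
move=> h; split; apply: norm_cvg0; apply: squeeze_cvgr (cvg_cst 0) h;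
  apply: nearW => n; rewrite normr_ge0 /=.
  exact: Re_le_normc.
exact: Im_le_normc.
Qed.

Lemma cintegral_exact_derivative (f F : R -> R[i]) :
  (forall t : R, 0 < t -> is_cderive F t (f t)) ->
  (forall t : R, 0 < t -> exists d, is_cderive f t d) ->
  (forall t, t <= 0 -> f t = 0) -> cintegrableT f ->
  ccvg (fun n => F n.+2%:R) 0 -> ccvg (fun n => F n.+2%:R^-1) 0 ->
  cintegralT f = 0.
Proof.
move=> dF df f_le0 fi Fy F0; have [m1 m2] := cintegrable_measurable fi.
have cf (t : R) : 0 < t -> _ := fun t0 =>
  let: ex_intro _ d := df t t0 in is_cderive_continuous d.
apply: complexP => /=.
  apply: (@Rintegral_exact_derivative _ (fun t => complex.Re (f t))
    (fun t => complex.Re (F t))) => //.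
  - by move=> t /dF[].
  - by move=> t /cf[].
  - by move=> t /f_le0 ->.
  - exact: fi.1.
  - exact: Fy.1.
  - exact: F0.1.
apply: (@Rintegral_exact_derivative _ (fun t => complex.Im (f t))
  (fun t => complex.Im (F t))) => //.
- by move=> t /dF[].
- by move=> t /cf[].
- by move=> t /f_le0 ->.
- exact: fi.2.
- exact: Fy.2.
- exact: F0.2.
Qed.

End ComplexFTC.

(** * The confluent integral: integrand *)

Section LaplaceKernel.
Context {R : realType}.
Implicit Types (x t p : R) (b e : R[i]).

(** Exponential decay beats any power: apply
    [ln u <= u] to [u = d (1 + t)] with [d = x / m] and [m > M]. *)
Lemma exp_powR_bounded x (M : R) : 0 < x ->
  exists2 C : R, 0 <= C &
    forall t, 0 <= t -> expR (- (x * t)) * (1 + t) `^ M <= C.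
Proof.
move=> x0; pose m := Num.max M 0 + 1; pose d := x / m.
have m0 : 0 < m by rewrite ltr_wpDl// le_max lexx orbT.
have d0 : 0 < d by rewrite divr_gt0.
exists (expR (x - m * ln d)) => [|t t0]; first exact: expR_ge0.
have t1 : 0 < 1 + t by rewrite ltr_pwDl.
rewrite /powR gt_eqF// -expRD ler_expR.
have ln0 : 0 <= ln (1 + t) by rewrite ln_ge0// lerDl.
have lnd : ln d + ln (1 + t) <= d * (1 + t).
  by rewrite -lnM ?posrE// ltW// ln_sublinear// mulr_gt0.
have Mm : M * ln (1 + t) <= m * ln (1 + t).
  rewrite ler_wpM2r// /m (@le_trans _ _ (Num.max M 0))// ?lerDl// le_max lexx//.
have : m * (ln d + ln (1 + t)) <= m * (d * (1 + t)) by rewrite ler_wpM2l// ltW.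
have -> : m * (d * (1 + t)) = x * (1 + t) by rewrite /d; field; rewrite gt_eqF.
lra.
Qed.

(** For positive [p] this is the derivative of [(t / (1 + t)) ^ p / p] on the
    positive reals, so it is integrable; it dominates all the kernels below. *)
Definition half_line_bound p t : R :=
  if 0 < t then expR ((p - 1) * ln t - (p + 1) * ln (1 + t)) else 0.

Lemma half_line_bound_ge0 p t : 0 <= half_line_bound p t.
Proof. by rewrite /half_line_bound; case: ifP => // _; exact: expR_ge0. Qed.

Lemma is_derive_ln1p t : 0 < t ->
  is_derive t (1 : R) (fun y : R => ln (1 + y)) (1 + t)^-1.
Proof.
move=> t0.
have h : is_derive (1 + t) (1 : R) (@ln R) (1 + t)^-1.
  by apply: is_derive1_ln; rewrite ltr_pwDl// ltW.
have h2 : is_derive t (1 : R) (fun y : R => 1 + y) 1.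
  apply: is_derive_eq (is_deriveD (is_derive_cst (1 : R) _ _) (is_derive_id _ _)) _.
  by rewrite add0r.
by apply: is_derive_eq (is_derive1_comp h h2) _; rewrite mulr1.
Qed.

Lemma half_line_bound_integrable p : 0 < p -> Rintegrable (half_line_bound p).
Proof.
move=> p0.
have near_eq t : 0 < t -> {near t,
    (fun y => expR ((p - 1) * ln y - (p + 1) * ln (1 + y))) =1 half_line_bound p}.
  move=> t0; near=> y; rewrite /half_line_bound ifT//; near: y; exact: lt_nbhsr.
apply: (@ge0_bounded_primitive_integrable _ (half_line_bound p)
  (fun t => p^-1 * expR (p * (ln t - ln (1 + t)))) _ _ _ _ p^-1).
- move=> t t0.
  have h1 := is_derive1_ln t0; have h2 := is_derive_ln1p t0.
  have t1 : 0 < 1 + t by rewrite ltr_pwDl// ltW.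
  have h3 : is_derive t (1 : R) (fun y : R => p * (ln y - ln (1 + y)))
      (p * (t^-1 - (1 + t)^-1)).
    by apply: is_derive_eq; rewrite /GRing.scale /=; ring.
  have h4 : is_derive t (1 : R) (fun y : R => expR (p * (ln y - ln (1 + y))))
      (expR (p * (ln t - ln (1 + t))) * (p * (t^-1 - (1 + t)^-1))).
    exact: (is_derive1_comp (f := expR)).
  apply: is_derive_eq; rewrite /GRing.scale /= /half_line_bound t0.
  have -> : (p - 1) * ln t - (p + 1) * ln (1 + t) =
     p * (ln t - ln (1 + t)) + (- ln t) + (- ln (1 + t)) by ring.
  rewrite !expRD !expRN !lnK ?posrE//; field.
  by rewrite !gt_eqF.
- move=> t t0.
  have h1 := is_derive1_ln t0; have h2 := is_derive_ln1p t0.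
  have h3 : is_derive t (1 : R)
      (fun y : R => (p - 1) * ln y - (p + 1) * ln (1 + y))
      ((p - 1) * t^-1 - (p + 1) * (1 + t)^-1).
    by apply: is_derive_eq; rewrite /GRing.scale /=; ring.
  have h4 := near_eq_is_derive (near_eq t t0)
    (is_derive1_comp (is_derive_expR _) h3).
  apply: differentiable_continuous; apply/derivable1_diffP.
  exact: (@ex_derive _ _ _ _ _ _ _ h4).
- have -> : half_line_bound p = fun t => (0 < t)%R%:R *
      expR ((p - 1) * ln t - (p + 1) * ln (1 + t)).
    by apply/funext => t; rewrite /half_line_bound; case: ifP; rewrite ?mul1r ?mul0r.
  apply: measurable_funM.
    apply: (measurableT_comp (f := fun b : bool => (b%:R : R))) => //.
    by apply: measurable_fun_ltr => //; exact: measurable_cst.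
  apply: measurableT_comp (@measurable_expR R) _.
  apply: measurable_funB; apply: measurable_funM => //.
  apply: measurableT_comp (@measurable_ln R) _; exact: measurable_funD.
- by move=> t t0; rewrite /half_line_bound ltNge t0.
- exact: half_line_bound_ge0.
- move=> t t0; rewrite normrM !ger0_norm ?expR_ge0 ?invr_ge0 ?(ltW p0)//.
  rewrite -[leRHS]mulr1 ler_wpM2l ?invr_ge0 ?(ltW p0)// expR_le1.
  rewrite pmulr_rle0// subr_le0 ler_ln ?posrE ?lerDr//.
  by rewrite ltr_pwDl// ltW.
Unshelve. all: by end_near. Qed.

(** The integral of this kernel over the half-line is
    [Gamma(b) U(b, b + e + 1, x)], where [U] is the confluent hypergeometric
    function of the second kind. *)
Definition laplace_kernel x b e t : R[i] :=
  (expR (- (x * t)))%:C%C * cpow t (b - 1) * cpow (1 + t) e.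

Definition laplace_integral x b e : R[i] := cintegralT (laplace_kernel x b e).

Lemma laplace_kernel_le0 x b e t : t <= 0 -> laplace_kernel x b e t = 0.
Proof. by move=> t0; rewrite /laplace_kernel cpow_le0// mulr0 mul0r. Qed.

Lemma normc_laplace_kernel x b e t : 0 < t ->
  normc (laplace_kernel x b e t) =
  expR (- (x * t)) * t `^ (complex.Re b - 1) * (1 + t) `^ complex.Re e.
Proof.
move=> t0; rewrite /laplace_kernel !normcM normc_real ger0_norm ?expR_ge0//.
rewrite !normc_cpow ?ltr_pwDl ?(ltW t0)//.
by rewrite ReD ReN.
Qed.

Lemma cmeasurable_laplace_kernel x b e :
  cmeasurable (laplace_kernel x b e : measurableTypeR R -> R[i]).
Proof.
apply: cmeasurableM; last first.
  by apply: cmeasurable_cpow; exact: measurable_funD.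
apply: cmeasurableM; last exact: cmeasurable_cpow.
apply: cmeasurable_real; apply: measurableT_comp (@measurable_expR R) _.
by apply: measurableT_comp => //; exact: measurable_funM.
Qed.

Lemma laplace_kernel_dominated x b e : 0 < x -> exists2 C, 0 <= C & forall t,
  normc (laplace_kernel x b e t) <= C * half_line_bound (complex.Re b) t.
Proof.
move=> x0; set p := complex.Re b.
have [C C0 HC] := exp_powR_bounded (complex.Re e + (p + 1)) x0.
exists C => // t; have [t0|t0] := leP t 0.
  by rewrite laplace_kernel_le0// normc0 mulr_ge0// half_line_bound_ge0.
have t1 : 0 < 1 + t by rewrite ltr_pwDl// ltW.
rewrite normc_laplace_kernel// /half_line_bound t0 expRB.
apply: le_trans (_ : (expR (- (x * t)) * (1 + t) `^ (complex.Re e + (p + 1))) *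
  (expR ((p - 1) * ln t) / expR ((p + 1) * ln (1 + t))) <= _); last first.
  apply: ler_wpM2r; last exact: HC (ltW t0).
  by rewrite divr_ge0// expR_ge0.
rewrite /powR (gt_eqF t0) !(gt_eqF t1) [(_ + (p + 1)) * _]mulrDl expRD.
rewrite le_eqVlt; apply/orP; left; apply/eqP; field.
by rewrite gt_eqF// expR_gt0.
Qed.

Lemma laplace_kernel_integrable x b e : 0 < x -> 0 < complex.Re b ->
  cintegrableT (laplace_kernel x b e).
Proof.
move=> x0 b0; have [C C0 h] := laplace_kernel_dominated b e x0.
apply: cintegrable_dominated h _; first exact: cmeasurable_laplace_kernel.
by apply: RintegrableZ; exact: half_line_bound_integrable.
Qed.

(** Splitting one factor [1 + t] gives the contiguity relation of the
    integrals. *)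
Lemma laplace_kernelS x b e t :
  laplace_kernel x b (e + 1) t = laplace_kernel x b e t + laplace_kernel x (b + 1) e t.
Proof.
rewrite /laplace_kernel cpowD1 realcD (_ : b + 1 - 1 = b - 1 + 1); last by ring.
rewrite cpowD1; ring.
Qed.

Lemma laplace_integralS x b e : 0 < x -> 0 < complex.Re b ->
  laplace_integral x b (e + 1) = laplace_integral x b e + laplace_integral x (b + 1) e.
Proof.
move=> x0 b0; rewrite /laplace_integral -cintegralD.
- by congr cintegralT; apply/funext => t; exact: laplace_kernelS.
- exact: laplace_kernel_integrable.
- by apply: laplace_kernel_integrable => //; rewrite ReD addr_gt0.
Qed.

Lemma is_cderive_exp_linear (x y : R) :
  is_cderive (fun t : R => (expR (- (x * t)))%:C%C) y
    (- x%:C%C * (expR (- (x * y)))%:C%C).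
Proof.
have h : is_derive y (1 : R) (fun t : R => - (x * t)) (- x).
  by apply: is_derive_eq; rewrite /GRing.scale /=; ring.
apply: is_cderive_eq (is_cderive_real (is_derive1_comp (is_derive_expR _) h)) _.
by rewrite realcM realcN mulrC.
Qed.

Lemma is_cderive_laplace_kernel x b e t : 0 < t ->
  is_cderive (laplace_kernel x b e) t
    (- x%:C%C * laplace_kernel x b e t + (b - 1) * laplace_kernel x (b - 1) e t
     + e * laplace_kernel x b (e - 1) t).
Proof.
move=> t0; have t1 : 0 < 1 + t by rewrite ltr_pwDl// ltW.
have h1 := is_cderive_exp_linear x t.
have h2 := is_cderive_cpow (b - 1) t0.
have h3 : is_cderive (fun y => cpow (1 + y) e) t (e * cpow (1 + t) (e - 1)).
  apply: (@is_cderive_near _ (fun y => cexp (e * (ln (1 + y))%:C%C))).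
    near=> y; rewrite cpowE// ltr_pwDl// ltW//; near: y; exact: lt_nbhsr.
  have h := is_cderive_cexp (is_cderiveZ e (is_cderive_real (is_derive_ln1p t0))).
  apply: is_cderive_eq h _.
  by rewrite -mulrA cpowD cpowN// cpow_powR1// -cpowE// realcV [_ * (cpow _ _)]mulrC.
apply: is_cderive_eq (is_cderiveM (is_cderiveM h1 h2) h3) _.
by rewrite /laplace_kernel; ring.
Unshelve. all: by end_near. Qed.

End LaplaceKernel.

(** * The confluent integral: derivative and integration by parts *)

Section LaplaceIntegral.
Context {R : realType}.
Notation mu := (@lebesgue_measure R).
Implicit Types (x t p : R) (b e : R[i]).

Lemma normc_laplace_kernel_le x y b e t : x <= y ->
  normc (laplace_kernel y b e t) <= normc (laplace_kernel x b e t).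
Proof.
move=> xy; have [t0|t0] := leP t 0; first by rewrite !laplace_kernel_le0.
rewrite !normc_laplace_kernel// -!mulrA ler_wpM2r//.
  by rewrite mulr_ge0// powR_ge0.
by rewrite ler_expR lerN2 ler_wpM2r// ltW.
Qed.

Lemma is_cderive_laplace_kernel_param x b e t :
  is_cderive (fun y => laplace_kernel y b e t) x (- laplace_kernel x (b + 1) e t).
Proof.
have h := is_cderive_exp_linear t x.
have {h}h : is_cderive (fun y => (expR (- (y * t)))%:C%C) x
    (- t%:C%C * (expR (- (x * t)))%:C%C).
  by under eq_fun do rewrite mulrC; rewrite [x * t]mulrC.
apply: is_cderive_eq (is_cderiveM (is_cderiveM h (is_cderive_cst (cpow t (b - 1)) x))
  (is_cderive_cst (cpow (1 + t) e) x)) _.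
rewrite /laplace_kernel (_ : b + 1 - 1 = b - 1 + 1); last by ring.
by rewrite cpowD1; ring.
Qed.

Lemma is_derive_Rintegral (f df : R -> R -> R) (G : R -> R) (x u v : R) :
  x \in `]u, v[ -> (forall y, y \in `]u, v[ -> Rintegrable (f y)) ->
  (forall y t, is_derive y (1 : R) (f ^~ t) (df y t)) ->
  (forall y t, y \in `]u, v[ -> `|df y t| <= G t) -> Rintegrable G ->
  is_derive x (1 : R) (fun y => Rintegral mu setT (f y))
    (Rintegral mu setT (df x)).
Proof.
move=> xI fi fd dG iG.
have G0 t : 0 <= G t by exact: le_trans (normr_ge0 _) (dG x t xI).
have dE y t : partial1of2 f y t = df y t.
  by rewrite partial1of2E; exact: (derive_val (is_derive := fd y t)).
have fder y t : `]u, v[%classic y -> setT t -> derivable (f ^~ t) y 1.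
  by move=> _ _; exact: (@ex_derive _ _ _ _ _ _ _ (fd y t)).
have gub y t : `]u, v[%classic y -> setT t -> `|partial1of2 f y t| <= G t.
  by move=> yI _; rewrite dE; exact: dG.
have h1 := @derivable_under_integral R _ _ mu f setT measurableT x u v
  xI fi fder G G0 iG gub.
have h2 := @differentiation_under_integral R _ _ mu f setT measurableT x u v
  xI fi fder G G0 iG gub.
apply: DeriveDef; first exact: h1.
by rewrite -derive1E h2; apply: eq_Rintegral => t _; rewrite dE.
Qed.

Lemma is_cderive_laplace_integral x b e : 0 < x -> 0 < complex.Re b ->
  is_cderive (fun y => laplace_integral y b e) x (- laplace_integral x (b + 1) e).
Proof.
move=> x0 b0.
have xI : x \in `]x / 2, x + 1[ by rewrite in_itv /=; apply/andP; split; lra.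
have b1 : 0 < complex.Re (b + 1) by rewrite ReD addr_gt0.
have x2 : 0 < x / 2 by rewrite divr_gt0.
(* For parameters above [x / 2], the kernel at [x / 2] is a majorant. *)
have [C C0 HC] := laplace_kernel_dominated (b + 1) e x2.
pose G t := C * half_line_bound (complex.Re (b + 1)) t.
have iG : Rintegrable G by apply: RintegrableZ; exact: half_line_bound_integrable.
have dG y t : y \in `]x / 2, x + 1[ -> normc (- laplace_kernel y (b + 1) e t) <= G t.
  rewrite in_itv /= => /andP[h _]; rewrite normcN.
  exact: le_trans (normc_laplace_kernel_le _ _ _ (ltW h)) (HC t).
have i1 y : y \in `]x / 2, x + 1[ -> cintegrableT (laplace_kernel y b e).
  rewrite in_itv /= => /andP[h _]; apply: laplace_kernel_integrable => //.
  exact: lt_trans h.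
have -> : - laplace_integral x (b + 1) e =
    cintegralT (fun t => - laplace_kernel x (b + 1) e t).
  rewrite -mulN1r -cintegralZ; last exact: laplace_kernel_integrable.
  by under eq_fun do rewrite mulN1r.
split.
  apply: (@is_derive_Rintegral (fun y t => complex.Re (laplace_kernel y b e t))
    (fun y t => complex.Re (- laplace_kernel y (b + 1) e t)) G _ _ _ xI) => // [y /i1[]//|y t|y t yI].
    exact: (is_cderive_laplace_kernel_param y b e t).1.
  by apply: le_trans (Re_le_normc _) _; exact: dG.
apply: (@is_derive_Rintegral (fun y t => complex.Im (laplace_kernel y b e t))
  (fun y t => complex.Im (- laplace_kernel y (b + 1) e t)) G _ _ _ xI) => // [y /i1[]//|y t|y t yI].
  exact: (is_cderive_laplace_kernel_param y b e t).2.
by apply: le_trans (Im_le_normc _) _; exact: dG.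
Qed.

Lemma cvg_invn2 : (n.+2%:R^-1 : R) @[n --> \oo] --> (0 : R).
Proof.
have := @cvg_harmonic R; rewrite -(cvg_shiftS (@harmonic R)).
by apply: cvg_trans; apply: near_eq_cvg; exact: nearW.
Qed.

(** Integration by parts in the confluent integral: the three terms add up to
    the derivative of [exp (- x t) t ^ b (1 + t) ^ (e + 1)]. *)
Lemma laplace_integral_by_parts x b e : 0 < x -> 0 < complex.Re b ->
  b * laplace_integral x b (e + 1) + (e + 1) * laplace_integral x (b + 1) e =
  x%:C%C * laplace_integral x (b + 1) (e + 1).
Proof.
move=> x0 b0; have b1 : 0 < complex.Re (b + 1) by rewrite ReD addr_gt0.
have i1 := laplace_kernel_integrable (e + 1) x0 b0.
have i2 := laplace_kernel_integrable e x0 b1.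
have i3 := laplace_kernel_integrable (e + 1) x0 b1.
pose f t := - x%:C%C * laplace_kernel x (b + 1) (e + 1) t +
  b * laplace_kernel x b (e + 1) t + (e + 1) * laplace_kernel x (b + 1) e t.
have fi : cintegrableT f.
  by apply: cintegrableD; [apply: cintegrableD|]; exact: cintegrableZ.
have f0 : cintegralT f = 0.
  apply: (@cintegral_exact_derivative _ f (laplace_kernel x (b + 1) (e + 1))) => //.
  - move=> t t0; apply: is_cderive_eq (is_cderive_laplace_kernel _ _ _ t0) _.
    by rewrite /f !addrK.
  - move=> t t0; eexists.
    apply: is_cderiveD; [apply: is_cderiveD|]; apply: is_cderiveZ;
      exact: is_cderive_laplace_kernel.
  - by move=> t t0; rewrite /f !laplace_kernel_le0// !mulr0 !addr0.
  - have [C C0 HC] := exp_powR_bounded (complex.Re b + complex.Re e + 2) x0.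
    apply: ccvg_norm0; apply: (@squeeze_cvgr _ _ _ _ (cst 0) (fun n => C * n.+2%:R^-1)).
    + near=> n; rewrite normc_ge0 /= normc_laplace_kernel//.
      have n0 : 0 < n.+2%:R :> R by [].
      rewrite ler_pdivlMr//.
      apply: le_trans (HC n.+2%:R _); last by rewrite ltW.
      rewrite -!mulrA ler_wpM2l ?expR_ge0// !ReD /= addrK.
      have n1 : 0 < 1 + n.+2%:R :> R by rewrite ltr_pwDl.
      have -> : complex.Re b + complex.Re e + 2 = complex.Re b + (complex.Re e + 1 + 1) by ring.
      rewrite [leRHS]powRD ?(gt_eqF n1) ?implybT//.
      have lnn : ln n.+2%:R <= ln (1 + n.+2%:R : R) by rewrite ler_ln ?posrE ?lerDr.
      apply: ler_pM => //; rewrite ?powR_ge0// ?mulr_ge0 ?powR_ge0//.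
        by rewrite /powR !gt_eqF// ler_expR ler_wpM2l// ltW.
      rewrite [(1 + n.+2%:R) `^ (_ + 1 + 1)]powRD ?(gt_eqF n1) ?implybT//.
      by rewrite ler_wpM2l ?powR_ge0// powRr1 ?(ltW n1)// lerDr.
    + exact: cvg_cst.
    + by rewrite -(mulr0 C); apply: cvgM; [exact: cvg_cst|exact: cvg_invn2].
  - have [C C0 HC] := exp_powR_bounded (complex.Re e + 1) x0.
    apply: ccvg_norm0; apply: (@squeeze_cvgr _ _ _ _ (cst 0)
      (fun n => C * (n.+2%:R^-1) `^ complex.Re b)).
    + near=> n; rewrite normc_ge0 /= normc_laplace_kernel ?invr_gt0//.
      rewrite mulrAC !ReD /= addrK ler_wpM2r ?powR_ge0//.
      by apply: HC; rewrite invr_ge0.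
    + exact: cvg_cst.
    + rewrite -(mulr0 C); apply: cvgM; first exact: cvg_cst.
      have /cvg_at_rightP := powR_cvg0 b0; apply; split => //.
      exact: cvg_invn2.
move: f0; rewrite /f cintegralD; last first.
- exact: cintegrableZ.
- by apply: cintegrableD; exact: cintegrableZ.
rewrite cintegralD; [|exact: cintegrableZ|exact: cintegrableZ].
rewrite (cintegralZ _ i1) (cintegralZ _ i2) (cintegralZ _ i3).
rewrite -addrA mulNr addrC => /eqP; rewrite subr_eq0 => /eqP.
by [].
Unshelve. all: by end_near. Qed.

End LaplaceIntegral.

(** * The Gamma function on the right half-plane *)

Section ComplexGamma.
Context {R : realType}.
Notation mu := (@lebesgue_measure R).
Implicit Types (x t p y : R) (b e : R[i]).

Definition cGamma b : R[i] := laplace_integral 1 b 0.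

(** Integration by parts with [e = -1], where one of the terms drops out. *)
Lemma cGammaS b : 0 < complex.Re b -> cGamma (b + 1) = b * cGamma b.
Proof.
move=> b0; have := laplace_integral_by_parts (-1) ltr01 b0.
by rewrite addNr mul0r addr0 mul1r /cGamma.
Qed.

Lemma sin_le y : 0 <= y -> `|sin y| <= y.
Proof.
move=> y0; have [|c _] := MVT_segment y0 (fun z _ => is_derive_sin z).
  by apply: continuous_subspaceT => z; exact: continuous_sin.
by rewrite sin0 !subr0 => ->; rewrite normrM (ger0_norm y0) ler_piMl// cos_max.
Qed.

Lemma cos_ge y : 1 - y ^+ 2 / 2 <= cos y.
Proof.
wlog y0 : y / 0 <= y => [h|].
  by rewrite -cos_norm -real_normK ?num_real//; exact: h.
have -> : cos y = 1 - 2 * sin (y / 2) ^+ 2.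
  rewrite {1}(_ : y = (y / 2) *+ 2); last by rewrite mulr2n; field.
  by rewrite cos_mulr2n cos2sin2 mulr2n; ring.
have y2 : 0 <= y / 2 by rewrite divr_ge0.
have : `|sin (y / 2)| ^+ 2 <= (y / 2) ^+ 2 by rewrite lerXn2r ?nnegrE// sin_le.
rewrite real_normK ?num_real// => h.
have -> : y ^+ 2 / 2 = 2 * (y / 2) ^+ 2 by field.
by rewrite lerD2l lerN2 ler_wpM2l.
Qed.

(** The right-hand side is [(2 (u - 1 / u)) ^ 2] for [u] the square root of [t].
    Being a combination of [t] and [1 / t], it integrates explicitly against
    [t ^ (p - 1) exp (- t)] by the functional equation. *)
Lemma sqr_ln_le t : 0 < t -> ln t ^+ 2 <= 4 * (t - 2 + t^-1).
Proof.
move=> t0; pose u := expR (ln t / 2); have u0 : 0 < u := expR_gt0 _.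
have uu : u ^+ 2 = t.
  by rewrite /u expr2 -expRD (_ : ln t / 2 + ln t / 2 = ln t) ?lnK ?posrE//; field.
have -> : t - 2 + t^-1 = (u - u^-1) ^+ 2.
  by rewrite -uu; field; rewrite gt_eqF.
have -> : 4 * (u - u^-1) ^+ 2 = (2 * (u - u^-1)) ^+ 2 by ring.
rewrite -(real_normK (num_real (ln t))) -(real_normK (num_real (2 * _))).
rewrite lerXn2r ?nnegrE//.
have h1 : 1 + ln t / 2 <= u by exact: expR_ge1Dx.
have h2 : 1 + (- (ln t / 2)) <= u^-1 by rewrite -expRN; exact: expR_ge1Dx.
have [l0|l0] := leP 0 (ln t).
  have h3 : u^-1 <= 1 by rewrite -expRN expR_le1 oppr_le0 divr_ge0.
  by rewrite !ger0_norm; lra.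
have h3 : u <= 1 by rewrite expR_le1 pmulr_lle0 ?invr_gt0// ltW.
by rewrite (ltr0_norm l0) ler0_norm; lra.
Qed.

Let gam p t : R := complex.Re (laplace_kernel 1 p%:C%C 0 t).

Let gamE p t : 0 < t -> gam p t = expR (- t + (p - 1) * ln t).
Proof.
move=> t0; rewrite /gam /laplace_kernel cpow0 ?ltr_pwDl ?(ltW t0)// mulr1 mul1r.
by rewrite -[X in _ - X]/(1%:C%C) -realcN -realcD cpow_real// -realcM /= /powR gt_eqF// -expRD.
Qed.

Let gam_le0 p t : t <= 0 -> gam p t = 0.
Proof. by move=> t0; rewrite /gam laplace_kernel_le0. Qed.

Let gam_ge0 p t : 0 <= gam p t.
Proof.
by have [t0|t0] := leP t 0; [rewrite gam_le0|rewrite gamE// expR_ge0].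
Qed.

Let gam_integrable p : 0 < p -> Rintegrable (gam p).
Proof. by move=> p0; exact: (laplace_kernel_integrable (b := p%:C%C) 0 ltr01 p0).1. Qed.

Let rGamma p := Rintegral mu setT (gam p).

Let rGammaS p : 0 < p -> rGamma (p + 1) = p * rGamma p.
Proof.
move=> p0; have := @cGammaS p%:C%C p0.
rewrite -[X in _ + X]/(1%:C%C) -realcD => /(congr1 (@complex.Re R)).
by rewrite ReM /= mul0r subr0.
Qed.

Let rGamma_gt0 p : 1 <= p -> 0 < rGamma p.
Proof.
move=> p1; have p0 : 0 < p by exact: lt_le_trans p1.
(* Between 1 and 2 the factors of the integrand are bounded below, by
   [exp (- 2)] and by 1. *)
pose g t : R := expR (-2) * \1_`[1, 2] t.
have ind : Rintegrable (\1_(`[1, 2]%classic : set R) : R -> R).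
  exact: integrable_indic_itv.
have gi : Rintegrable g by exact: RintegrableZ.
apply: lt_le_trans (_ : Rintegral mu setT g <= _).
  rewrite /g RintegralZl// mulr_gt0 ?expR_gt0//.
  have m12 : mu (`[1, 2]%classic : set R) = 1%:E.
    by rewrite lebesgue_measure_itv /= lte_fin ltr1n -EFinB; congr EFin; lra.
  have -> : Rintegral mu setT (\1_(`[1, 2]%classic : set R) : R -> R) = 1.
    by rewrite /Rintegral integral_indic// setIT; exact: (congr1 fine m12).
  exact: ltr01.
apply: le_Rintegral => //; first exact: gam_integrable.
move=> t _; rewrite /g indicE.
case: (boolP (t \in `[1, 2]%classic)) => [|_]; last by rewrite mulr0; exact: gam_ge0.
rewrite inE /= in_itv /= => /andP[t1 t2]; rewrite mulr1.
rewrite -/(gam p t) gamE ?(lt_le_trans _ t1)// ler_expR.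
by have := mulr_ge0 (_ : 0 <= p - 1) (ln_ge0 t1); rewrite subr_ge0 => /(_ p1); lra.
Qed.

(** For a real part [p] large compared with the imaginary part, the factor
    [t ^ (i y)] is nearly constant on the bulk of the density
    [t ^ (p - 1) exp (- t)], which is concentrated near [t = p]. After rotation
    by [p ^ (- i y)], the real part of the integrand is the density times
    [cos (y ln (t / p)) >= 1 - 2 y ^ 2 (t / p - 2 + p / t)], and the integral of
    the lower bound is [Gamma p * (1 - 2 y ^ 2 / (p - 1))]. *)
Let cGamma_large_neq0 p y : 1 + 2 * y ^+ 2 < p -> cGamma (p +i* y)%C != 0.
Proof.
move=> py; have p1 : 1 < p by apply: le_lt_trans py; rewrite lerDl mulr_ge0 ?sqr_ge0.
have p0 : 0 < p by exact: lt_trans p1.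
have pm0 : 0 < p - 1 by rewrite subr_gt0.
pose c := cexp (0 +i* (- (y * ln p)))%C.
pose low t := (1 + 4 * y ^+ 2) * gam p t +
  (- (2 * y ^+ 2 / p) * gam (p + 1) t + - (2 * y ^+ 2 * p) * gam (p - 1) t).
have b0 : 0 < complex.Re (p +i* y)%C by [].
have ik := laplace_kernel_integrable 0 ltr01 b0.
have lowP t : low t <= complex.Re (c * laplace_kernel 1 (p +i* y)%C 0 t).
  have [t0|t0] := leP t 0.
    by rewrite /low !gam_le0// laplace_kernel_le0// !mulr0 !addr0.
  have -> : complex.Re (c * laplace_kernel 1 (p +i* y)%C 0 t) =
      gam p t * cos (y * ln (t / p)).
    rewrite /laplace_kernel cpow0 ?ltr_pwDl ?(ltW t0)// mulr1 mul1r cpowE//.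
    rewrite -cexp_real mulrC -mulrA -!cexpD gamE// /cexp ln_div ?posrE//.
    rewrite !ReD !ImD ReM ImM !ReD !ImD !ReN !ImN /=.
    by congr (expR _ * cos _); ring.
  have tp : 0 < t / p by rewrite divr_gt0.
  have h1 := cos_ge (y * ln (t / p)).
  have h2 := sqr_ln_le tp.
  have h3 : y ^+ 2 * ln (t / p) ^+ 2 <= y ^+ 2 * (4 * (t / p - 2 + (t / p)^-1)).
    by rewrite ler_wpM2l// sqr_ge0.
  have h4 : 1 - 2 * y ^+ 2 * (t / p - 2 + (t / p)^-1) <= cos (y * ln (t / p)).
    by apply: le_trans h1; rewrite exprMn; lra.
  apply: le_trans (ler_wpM2l (gam_ge0 p t) h4).
  have lnt : expR (ln t) = t by rewrite lnK ?posrE.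
  have g1 : gam (p + 1) t = t * gam p t.
    rewrite !gamE// -{3}lnt -expRD; congr expR; ring.
  have g2 : gam (p - 1) t = t^-1 * gam p t.
    rewrite !gamE// -{3}lnt -expRN -expRD; congr expR; ring.
  rewrite /low g1 g2 le_eqVlt; apply/orP; left; apply/eqP; field.
  by rewrite !gt_eqF.
have i1 := gam_integrable p0.
have i2 := gam_integrable (addr_gt0 p0 ltr01).
have i3 := gam_integrable pm0.
have j23 : Rintegrable (fun t => - (2 * y ^+ 2 / p) * gam (p + 1) t +
    - (2 * y ^+ 2 * p) * gam (p - 1) t).
  by apply: RintegrableD; exact: RintegrableZ.
have ilow : Rintegrable low by apply: RintegrableD => //; exact: RintegrableZ.
have : Rintegral mu setT low <= complex.Re (c * cGamma (p +i* y)%C).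
  rewrite -cintegralZ//; apply: le_Rintegral => //.
    exact: (cintegrableZ c ik).1.
  by move=> t _; exact: lowP.
have -> : Rintegral mu setT low = rGamma p * (1 - 2 * y ^+ 2 / (p - 1)).
  rewrite /low RintegralD//; [|exact: RintegrableZ].
  rewrite RintegralD//; [|exact: RintegrableZ|exact: RintegrableZ].
  rewrite !RintegralZl// -!/(rGamma _) rGammaS//.
  have -> : rGamma p = (p - 1) * rGamma (p - 1) by rewrite -rGammaS// subrK.
  by field; rewrite !gt_eqF.
move=> h; apply/eqP => g0; move: h; rewrite g0 mulr0 /= leNgt => /negP; apply.
rewrite mulr_gt0 ?rGamma_gt0 ?(ltW p1)// subr_gt0 ltr_pdivrMr// mul1r; lra.
Qed.

(** The functional equation moves [b] to the right without changing its
    imaginary part. *)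
Lemma cGamma_neq0 b : 0 < complex.Re b -> cGamma b != 0.
Proof.
move=> b0.
have step n : cGamma (b + n%:R) != 0 -> cGamma b != 0.
  elim: n => [|n IH]; first by rewrite addr0.
  rewrite -natr1 addrA cGammaS; last by rewrite ReD -realc_nat /= ltr_pwDl.
  by rewrite mulf_eq0 negb_or => /andP[_ /IH].
pose n := (Num.truncn (1 + 2 * complex.Im b ^+ 2)).+1.
apply: (step n).
have hn : 1 + 2 * complex.Im b ^+ 2 < n%:R by exact: truncnS_gt.
have bE (k : nat) : b + k%:R = ((complex.Re b + k%:R) +i* complex.Im b)%C.
  by rewrite -realc_nat; apply: complexP; rewrite ?ReD ?ImD //= addr0.
rewrite bE.
by apply: cGamma_large_neq0; lra.
Qed.

Lemma cGamma_real p : cGamma p%:C%C = (Gamma p)%:C%C.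
Proof.
apply: complexP => /=.
  rewrite /Gamma [RHS]Rintegral_mkcond; apply: eq_Rintegral => t _; rewrite patchE.
  case: ifPn => [|/negP]; rewrite inE /= in_itv /= andbT.
    move=> t0; rewrite -/(gam p t) gamE// /powR gt_eqF// -expRD; congr expR; ring.
  by move=> /negP; rewrite -leNgt => t0; rewrite laplace_kernel_le0.
transitivity (Rintegral mu setT (fun=> 0 : R)); last by rewrite Rintegral_cst// mul0r.
apply: eq_Rintegral => t _; have [t0|t0] := leP t 0; first by rewrite laplace_kernel_le0.
rewrite /laplace_kernel cpow0 ?ltr_pwDl ?(ltW t0)// mulr1.
by rewrite -[X in _ - X]/(1%:C%C) -realcN -realcD cpow_real// -realcM.
Qed.

End ComplexGamma.

(** * The Euler integral solves the Whittaker equation *)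

Section WhittakerSolution.
Context {R : realType}.
Implicit Types (x t : R) (a b e l : R[i]).

(* This family contains its own derivatives. *)
Let G a b e x : R[i] := (expR (- x / 2))%:C%C * cpow x a * laplace_integral x b e.

Let is_cderive_G a b e x : 0 < x -> 0 < complex.Re b ->
  is_cderive (G a b e) x
    (- 2^-1 * G a b e x + a * G (a - 1) b e x - G a (b + 1) e x).
Proof.
move=> x0 b0.
have h1 : is_derive x (1 : R) (fun t : R => - t / 2) (- 2^-1).
  by apply: is_derive_eq; rewrite /GRing.scale /=; ring.
have h2 := is_cderive_real (is_derive1_comp (is_derive_expR _) h1).
have h3 := is_cderive_cpow a x0.
have h4 := is_cderive_laplace_integral e x0 b0.
apply: is_cderive_eq (is_cderiveM (is_cderiveM h2 h3) h4) _.
rewrite /G realcM realcN realcV (realc_nat 2); ring.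
Qed.

(** Up to the factor [Gamma (1 / 2 + l - k)], Euler's integral representation of
    the Whittaker function. *)
Definition whittaker_integral (k : R) l x : R[i] :=
  (expR (- x / 2))%:C%C * cpow x (l + 1 / 2) *
  laplace_integral x (1 / 2 + l - k%:C%C) (l - 1 / 2 + k%:C%C).

Lemma whittaker_integral_ode (k : R) l : 0 < complex.Re (1 / 2 + l - k%:C%C) ->
  exists u1 u2 : R -> R[i], forall x, 0 < x ->
  [/\ is_cderive (whittaker_integral k l) x (u1 x), is_cderive u1 x (u2 x) &
   u2 x + ((k / x)%:C%C - 1 / 4 + (1 / 4 - l ^+ 2) / (x ^+ 2)%:C%C) *
     whittaker_integral k l x = 0].
Proof.
set b := 1 / 2 + l - k%:C%C; set e := l - 1 / 2 + k%:C%C; set a := l + 1 / 2.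
move=> b0; have b1 : 0 < complex.Re (b + 1) by rewrite ReD addr_gt0.
exists (fun x => - 2^-1 * G a b e x + a * G (a - 1) b e x - G a (b + 1) e x).
eexists => x x0; split.
- exact: is_cderive_G.
- apply: is_cderiveD; [apply: is_cderiveD|].
  + by apply: is_cderiveZ; exact: is_cderive_G.
  + by apply: is_cderiveZ; exact: is_cderive_G.
  + by apply: is_cderiveN; exact: is_cderive_G.
have X0 : x%:C%C != 0 :> R[i] by rewrite realc_eq0 gt_eqF.
rewrite /whittaker_integral -/b -/e -/a /G !(cpowD _ _ (-1)) cpowN// cpow_powR1//.
(* Three contiguous integrals satisfy a linear relation; eliminating [J2], the
   equation becomes an identity in [J0] and [J1]. *)
have s1 := laplace_integralS e x0 b0.
have s2 := laplace_integralS e x0 b1.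
have s3 := laplace_integral_by_parts e x0 b0.
rewrite s1 s2 in s3.
set J0 := laplace_integral x b e in s1 s3 *.
set J1 := laplace_integral x (b + 1) e in s1 s2 s3 *.
set J2 := laplace_integral x (b + 1 + 1) e in s2 s3 *.
have J2E : J2 = (b * (J0 + J1) + (e + 1) * J1 - x%:C%C * J1) / x%:C%C.
  by rewrite s3; field.
rewrite J2E expr2 !realcM realcV.
by rewrite /b /e /a; field.
Qed.

Lemma is_cderive2_cderive (u u1 u2 : R -> R[i]) x : 0 < x ->
  (forall y, 0 < y -> is_cderive u y (u1 y)) ->
  (forall y, 0 < y -> is_cderive u1 y (u2 y)) ->
  [/\ cderivable u x, cderivable (cderive u) x & cderive (cderive u) x = u2 x].
Proof.
move=> x0 h1 h2; have h : is_cderive (cderive u) x (u2 x).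
  apply: is_cderive_near (h2 x x0); near=> y; apply/esym/is_cderiveE/h1.
  near: y; exact: lt_nbhsr.
split; [exact: is_cderive_cderivable (h1 x x0)|exact: is_cderive_cderivable h|].
exact: is_cderiveE.
Unshelve. all: by end_near. Qed.

(** Watson's lemma at leading order: after the scaling [t = r / x] the
    integrand tends to that of the Gamma function, boundedly. *)
Lemma laplace_integral_asymptotics b e : 0 < complex.Re b ->
  ccvg_pinfty (fun x => cpow x b * laplace_integral x b e) (cGamma b).
Proof.
move=> b0; pose M := `|complex.Re e|.
pose f x r := (expR (- r))%:C%C * cpow r (b - 1) * cpow (1 + x^-1 * r) e.
have [C C0 HC] := laplace_kernel_dominated b M%:C%C ltr01.
pose g r := C * half_line_bound (complex.Re b) r.
have gi : Rintegrable g by apply: RintegrableZ; exact: half_line_bound_integrable.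
have mf x : cmeasurable (f x : measurableTypeR R -> R[i]).
  apply: cmeasurableM; last first.
    by apply: cmeasurable_cpow; apply: measurable_funD => //; exact: measurable_funM.
  apply: cmeasurableM; last exact: cmeasurable_cpow.
  apply: cmeasurable_real; apply: measurableT_comp (@measurable_expR R) _.
  exact: oppr_measurable.
have fg x r : 1 <= x -> normc (f x r) <= g r.
  move=> x1; have x0 : 0 < x by exact: lt_le_trans x1.
  apply: le_trans (HC r); have [r0|r0] := leP r 0.
    by rewrite /f /laplace_kernel (cpow_le0 _ r0) !mulr0 !mul0r.
  have rx0 : 0 < x^-1 * r by rewrite mulr_gt0 ?invr_gt0.
  have r1 : 1 <= 1 + x^-1 * r by rewrite lerDl ltW.
  have r1' : 0 < 1 + x^-1 * r by exact: lt_le_trans r1.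
  have r2 : 0 < 1 + r by rewrite ltr_pwDl// ltW.
  rewrite normc_laplace_kernel// /f !normcM normc_real ger0_norm ?expR_ge0//.
  rewrite !normc_cpow// ReD ReN mul1r.
  rewrite ler_wpM2l ?mulr_ge0 ?expR_ge0 ?powR_ge0//=.
  apply: le_trans (_ : (1 + x^-1 * r) `^ M <= _).
    by apply: ler_powR => //; exact: ler_norm.
  rewrite /powR !gt_eqF// ler_expR ler_wpM2l ?normr_ge0// ler_ln ?posrE//.
  by rewrite lerD2l ler_piMl ?(ltW r0)// invf_le1.
have fE x : 1 <= x -> cpow x b * laplace_integral x b e = cintegralT (f x).
  move=> x1; have x0 : 0 < x by exact: lt_le_trans x1.
  have fi : cintegrableT (f x) by apply: cintegrable_dominated gi => // r; exact: fg.
  have x00 : x != 0 by rewrite gt_eqF.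
  rewrite (cintegral_affine 0 x00 fi) (ger0_norm (ltW x0)).
  have -> : (fun v => f x (0 + x * v)) =
      fun v => cpow x (b - 1) * laplace_kernel x b e v.
    apply/funext => v; rewrite /f /laplace_kernel add0r mulKf// cpowM//; ring.
  rewrite cintegralZ; last exact: laplace_kernel_integrable.
  by rewrite mulrA -cpowD1 subrK.
have key (u : nat -> R) : u n @[n --> \oo] --> +oo ->
    ccvg (fun n => cpow (u n) b * laplace_integral (u n) b e) (cGamma b).
  move=> uoo; pose y n := Num.max 1 (u n).
  have y1 n : 1 <= y n by rewrite le_max lexx.
  have uy : \forall n \near \oo, u n = y n.
    near=> n; rewrite /y; apply/esym/max_r; near: n.
    exact: (cvgry_ge uoo 1).
  have yoo : y n @[n --> \oo] --> +oo.
    by apply: cvg_trans uoo; apply: near_eq_cvg.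
  have yV : (y n)^-1 @[n --> \oo] --> (0 : R).
    apply/gtr0_cvgV0 => //; apply: nearW => n; rewrite /y.
    exact: lt_le_trans (y1 n).
  have [_ cI] : cintegrableT (laplace_kernel 1 b 0) /\
      ccvg (fun n => cintegralT (f (y n))) (cintegralT (laplace_kernel 1 b 0)).
    apply: (cdominated_convergence (fun n => mf (y n))) gi (fun n t => fg _ _ (y1 n)).
    move=> r; rewrite /f /laplace_kernel mul1r; have [r0|r0] := leP r 0.
      by rewrite (cpow_le0 _ r0) !mulr0 !mul0r; under eq_fun do rewrite mul0r; exact: ccvg_cst.
    apply: ccvgM; first exact: ccvg_cst.
    rewrite cpow0 ?ltr_pwDl ?(ltW r0)//.
    have [c1 c2] := is_cderive_continuous (is_cderive_cpow e (@ltr01 R)).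
    have c3 : 1 + (y n)^-1 * r @[n --> \oo] --> (1 : R).
      rewrite -[X in _ --> X]addr0 -[X in _ + X](mul0r r).
      by apply: cvgD; [exact: cvg_cst|apply: cvgM; [exact: yV|exact: cvg_cst]].
    rewrite -(cpow1 e); split.
      exact: (cvg_comp _ _ c3 c1).
    exact: (cvg_comp _ _ c3 c2).
  split.
    apply: cvg_trans cI.1; apply: near_eq_cvg; near=> n.
    by rewrite (near uy n) ?(fE _ (y1 n)).
  apply: cvg_trans cI.2; apply: near_eq_cvg; near=> n.
  by rewrite (near uy n) ?(fE _ (y1 n)).
by split; apply/cvg_pinftyP => u uoo; have [] := key u uoo.
Unshelve. all: by end_near. Qed.

Lemma ccvg_pinftyZ c (u : R -> R[i]) d : ccvg_pinfty u d ->
  ccvg_pinfty (fun x => c * u x) (c * d).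
Proof.
move=> [h1 h2]; split.
  rewrite ReM; under eq_fun do rewrite ReM.
  by apply: cvgB; apply: cvgM => //; exact: cvg_cst.
rewrite ImM; under eq_fun do rewrite ImM.
by apply: cvgD; apply: cvgM => //; exact: cvg_cst.
Qed.

Lemma ccvg_pinfty_near (u v : R -> R[i]) d : (\forall x \near +oo, u x = v x) ->
  ccvg_pinfty u d -> ccvg_pinfty v d.
Proof.
move=> uv [h1 h2]; split.
  by apply: cvg_trans h1; apply: near_eq_cvg; apply: filterS uv => x ->.
by apply: cvg_trans h2; apply: near_eq_cvg; apply: filterS uv => x ->.
Qed.

Lemma whittaker_integral_is_whittakerW (k : R) l :
  0 < complex.Re (1 / 2 + l - k%:C%C) ->
  is_whittakerW k l
    (fun x => (cGamma (1 / 2 + l - k%:C%C))^-1 * whittaker_integral k l x).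
Proof.
move=> b0; have g0 := cGamma_neq0 b0.
set c := (cGamma _)^-1; split.
  move=> x x0; have [u1 [u2 H]] := whittaker_integral_ode b0.
  have [d1 d2 d3] := @is_cderive2_cderive (fun y => c * whittaker_integral k l y)
    (fun y => c * u1 y) (fun y => c * u2 y) x x0
    (fun y y0 => let: And3 p _ _ := H y y0 in is_cderiveZ c p)
    (fun y y0 => let: And3 _ p _ := H y y0 in is_cderiveZ c p).
  split => //; rewrite d3 mulrCA -mulrDr.
  by have [_ _ ->] := H x x0; rewrite mulr0.
have cg : c * cGamma (1 / 2 + l - k%:C%C) = 1 by rewrite mulVf.
have := ccvg_pinftyZ c (laplace_integral_asymptotics (l - 1 / 2 + k%:C%C) b0).
rewrite cg; apply: ccvg_pinfty_near; near=> x.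
have x0 : 0 < x by near: x; exact: nbhs_pinfty_gt.
have -> : cpow x (1 / 2 + l - k%:C%C) = cpow x (l + 1 / 2) / (x `^ k)%:C%C.
  rewrite (_ : 1 / 2 + l - k%:C%C = (l + 1 / 2) + - k%:C%C); last by ring.
  by rewrite [LHS]cpowD cpowN// cpow_real.
rewrite /whittaker_integral realcM.
field.
by rewrite !fmorph_eq0 (gt_eqF (expR_gt0 _)) (gt_eqF (powR_gt0 k x0)).
Unshelve. all: by end_near. Qed.

End WhittakerSolution.

(** * Uniqueness of the Whittaker function *)

Section Uniqueness.
Context {R : realType}.
Implicit Types (x t : R) (l : R[i]).

Lemma ge_derivative_le (f df : R -> R) (a b m : R) : a <= b ->
  (forall t, a <= t <= b -> is_derive t (1 : R) f (df t)) ->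
  (forall t, a <= t <= b -> m <= df t) -> m * (b - a) <= f b - f a.
Proof.
move=> ab fd d0.
have fd' (t : R) : t \in `]a, b[ -> is_derive t (1 : R) f (df t).
  by rewrite in_itv /= => /andP[h1 h2]; apply: fd; rewrite !ltW.
have cf : {within `[a, b], continuous f}.
  apply: derivable_within_continuous => t; rewrite in_itv /= => h.
  exact: (@ex_derive _ _ _ _ _ _ _ (fd t h)).
have [c] := MVT_segment ab fd' cf.
by rewrite in_itv /= => h ->; rewrite ler_wpM2r ?subr_ge0// d0.
Qed.

Lemma zero_derivative_cst (f : R -> R) (a b : R) : a <= b ->
  (forall t, a <= t <= b -> is_derive t (1 : R) f 0) -> f a = f b.
Proof.
move=> ab fd; apply/eqP; rewrite eq_le.
have h1 := ge_derivative_le ab fd (fun _ _ => lexx 0).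
have fdN t : a <= t <= b -> is_derive t (1 : R) (fun y => - f y) 0.
  by move=> /fd h; apply: is_derive_eq; rewrite oppr0.
have h2 := ge_derivative_le ab fdN (fun _ _ => lexx 0).
by rewrite mul0r in h1 h2; apply/andP; split; lra.
Qed.

Lemma zero_cderivative_cst (u : R -> R[i]) (a b : R) : a <= b ->
  (forall t, a <= t <= b -> is_cderive u t 0) -> u a = u b.
Proof.
move=> ab h; apply: complexP.
  by apply: (@zero_derivative_cst (fun y => complex.Re (u y)) _ _ ab) => t /h[].
by apply: (@zero_derivative_cst (fun y => complex.Im (u y)) _ _ ab) => t /h[].
Qed.

(** Gronwall's argument: for a solution [d] of [d'' = - q d] the energy
    [|d|^2 + |d'|^2], multiplied by a suitable exponential, is monotone. *)
Lemma linear_ode_unique_backward (d d1 q : R -> R[i]) (a b K : R) : a <= b ->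
  (forall t, a <= t <= b -> is_cderive d t (d1 t)) ->
  (forall t, a <= t <= b -> is_cderive d1 t (- (q t * d t))) ->
  (forall t, a <= t <= b -> normc (q t) <= K) ->
  d b = 0 -> d1 b = 0 -> d a = 0.
Proof.
move=> ab h1 h2 hq db d1b.
pose E t := (complex.Re (d t) ^+ 2 + complex.Im (d t) ^+ 2) +
  (complex.Re (d1 t) ^+ 2 + complex.Im (d1 t) ^+ 2).
pose M := 1 + K + K.
pose dE t := 2 * (complex.Re (d t) * complex.Re (d1 t) + complex.Im (d t) * complex.Im (d1 t)
  + complex.Re (d1 t) * complex.Re (- (q t * d t))
  + complex.Im (d1 t) * complex.Im (- (q t * d t))).
have fd t : a <= t <= b -> is_derive t (1 : R) (fun y => expR (M * y) * E y)
    (expR (M * t) * (M * E t + dE t)).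
  move=> tab; have [r1 i1] := h1 t tab; have [r2 i2] := h2 t tab.
  have he : is_derive t (1 : R) (fun y : R => M * y) M.
    by apply: is_derive_eq; rewrite /GRing.scale /=; ring.
  have he2 : is_derive t (1 : R) (fun y : R => expR (M * y)) (expR (M * t) * M).
    exact: (is_derive1_comp (f := expR)).
  rewrite /E; apply: is_derive_eq.
  by rewrite /dE /GRing.scale /=; ring.
have fd0 t : a <= t <= b -> 0 <= expR (M * t) * (M * E t + dE t).
  move=> tab; rewrite mulr_ge0 ?expR_ge0//.
  have qr := le_trans (Re_le_normc (q t)) (hq t tab).
  have qi := le_trans (Im_le_normc (q t)) (hq t tab).
  rewrite /dE ReN ImN ReM ImM /E.
  set A := complex.Re (q t) in qr *; set B := complex.Im (q t) in qi *.
  set p := complex.Re (d t); set s := complex.Im (d t).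
  set p1 := complex.Re (d1 t); set s1 := complex.Im (d1 t).
  have bnd (c u v : R) : `|c| <= K -> - (K * (u ^+ 2 + v ^+ 2)) <= 2 * (c * u * v).
    move=> cK.
    have h3 : `|2 * (c * u * v)| <= K * (u ^+ 2 + v ^+ 2).
      rewrite (_ : 2 * (c * u * v) = c * (2 * (u * v))); last by ring.
      rewrite normrM; apply: ler_pM => //.
      rewrite ler_norml; apply/andP; split.
        by have := sqr_ge0 (u + v); rewrite sqrrD mulr2n; lra.
      by have := sqr_ge0 (u - v); rewrite sqrrB mulr2n; lra.
    by move: h3; rewrite ler_norml => /andP[].
  have b1 := bnd (- A) p p1; have b2 := bnd B s p1.
  have b3 := bnd (- A) s s1; have b4 := bnd (- B) p s1.
  rewrite !normrN in b1 b3 b4.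
  have b5 : - (p ^+ 2 + p1 ^+ 2) <= 2 * (p * p1).
    by have := sqr_ge0 (p + p1); rewrite sqrrD mulr2n; lra.
  have b6 : - (s ^+ 2 + s1 ^+ 2) <= 2 * (s * s1).
    by have := sqr_ge0 (s + s1); rewrite sqrrD mulr2n; lra.
  have := b1 qr; have := b2 qi; have := b3 qr; have := b4 qi.
  rewrite /M; nra.
have := ge_derivative_le ab fd fd0.
rewrite mul0r {1}/E db d1b /= expr0n /= !addr0 mulr0 sub0r oppr_ge0.
rewrite pmulr_rle0 ?expR_gt0// /E => h.
have h3 := sqr_ge0 (complex.Re (d a)); have h4 := sqr_ge0 (complex.Im (d a)).
have h5 := sqr_ge0 (complex.Re (d1 a)); have h6 := sqr_ge0 (complex.Im (d1 a)).
apply: complexP; apply/eqP; rewrite -sqrf_eq0 eq_le.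
  by apply/andP; split; lra.
by apply/andP; split; lra.
Qed.

Lemma whittaker_weight_le1 (k : R) : \forall x \near +oo,
  x `^ k * expR (- x / 2) <= 1.
Proof.
(* One half of [exp (- x / 2)] bounds the power, the other tends to zero. *)
have q0 : 0 < 4^-1 :> R by [].
have [C C0 HC] := exp_powR_bounded `|k| q0.
near=> x.
have x1 : 1 <= x by near: x; exact: nbhs_pinfty_ge.
have x0 : 0 < x by exact: lt_le_trans x1.
have xC : 4 * C <= x by near: x; apply: nbhs_pinfty_ge; rewrite num_real.
have h1 : x `^ k <= (1 + x) `^ `|k|.
  apply: le_trans (_ : x `^ `|k| <= _); first by apply: ler_powR => //; exact: ler_norm.
  by rewrite /powR !gt_eqF ?ltr_pwDl ?(ltW x0)// ler_expR ler_wpM2l// ler_ln ?posrE ?ltr_pwDl ?(ltW x0)// lerDr.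
have h2 := HC x (ltW x0).
have e1 : expR (- x / 2) = expR (- (4^-1 * x)) * expR (- (4^-1 * x)).
  by rewrite -expRD; congr expR; field.
rewrite e1 mulrA.
apply: le_trans (_ : C * expR (- (4^-1 * x)) <= _).
  rewrite ler_wpM2r ?expR_ge0//; apply: le_trans h2.
  by rewrite mulrC ler_wpM2l ?expR_ge0.
rewrite expRN ler_pdivrMr ?expR_gt0// mul1r.
by have := expR_ge1Dx (4^-1 * x); lra.
Unshelve. all: by end_near. Qed.

(** The function [z ^ (-2)] is close to 1 near 1; the radius 1/10 is one
    convenient choice. *)
Lemma Re_invsqr_ge (z : R[i]) : `|complex.Re z - 1| <= 10^-1 ->
  `|complex.Im z| <= 10^-1 -> 2^-1 <= complex.Re (z ^- 2).
Proof.
case: z => a b /= ha hb.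
have [a1 a2] : 9 / 10 <= a /\ a <= 11 / 10.
  by move: ha; rewrite ler_norml => /andP[h1 h2]; split; lra.
have [b1 b2] : - 10^-1 <= b /\ b <= 10^-1.
  by move: hb; rewrite ler_norml => /andP[h1 h2].
set A := a * a - b * b; set B := a * b + b * a.
have bb : b * b <= 10^-1 * 10^-1 by nra.
have aa1 : 81 / 100 <= a * a by nra.
have aa2 : a * a <= 121 / 100 by nra.
have bb0 : 0 <= b * b by nra.
have AB : A ^+ 2 + B ^+ 2 = (a * a + b * b) ^+ 2 by rewrite /A /B; ring.
have S1 : (a * a + b * b) ^+ 2 <= 3 / 2.
  rewrite expr2; nra.
have S0 : 0 < (a * a + b * b) ^+ 2 by rewrite expr2; nra.
have A1 : 4 / 5 <= A by rewrite /A; lra.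
by rewrite AB ler_pdivlMr//; lra.
Qed.

(** The Wronskian [C] of the difference [d] of two solutions and one of them,
    [w], is constant, and the ratio [rho = d / w] has derivative [C w ^ (-2)].
    For large [x], [w ^ (-2)] has real part at least 1/2, so [rho] can only tend
    to zero if [C = 0]; then [rho] is constant, hence zero. *)
Lemma is_whittakerW_unique (k : R) l (u w : R -> R[i]) :
  is_whittakerW k l u -> is_whittakerW k l w -> forall x, 0 < x -> u x = w x.
Proof.
move=> [uode ulim] [wode wlim].
pose Q x := (k / x)%:C%C - 1 / 4 + (1 / 4 - l ^+ 2) / (x ^+ 2)%:C%C : R[i].
have uD x : 0 < x -> is_cderive u x (cderive u x) /\
    is_cderive (cderive u) x (- (Q x * u x)).
  move=> /uode [h1 h2 h3]; split; first exact: cderivableP.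
  by apply: is_cderive_eq (cderivableP h2) _; apply/eqP; rewrite -addr_eq0 h3.
have wD x : 0 < x -> is_cderive w x (cderive w x) /\
    is_cderive (cderive w) x (- (Q x * w x)).
  move=> /wode [h1 h2 h3]; split; first exact: cderivableP.
  by apply: is_cderive_eq (cderivableP h2) _; apply/eqP; rewrite -addr_eq0 h3.
pose d x := u x - w x; pose d1 x := cderive u x - cderive w x.
have dD x : 0 < x -> is_cderive d x (d1 x) /\ is_cderive d1 x (- (Q x * d x)).
  move=> x0; have [h1 h2] := uD x x0; have [h3 h4] := wD x x0; split.
    by apply: is_cderiveD => //; exact: is_cderiveN.
  apply: is_cderive_eq (is_cderiveD h2 (is_cderiveN h4)) _.
  by rewrite /d; ring.
pose W x := d1 x * w x - d x * cderive w x.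
have WD x : 0 < x -> is_cderive W x 0.
  move=> x0; have [h1 h2] := dD x x0; have [h3 h4] := wD x x0.
  apply: is_cderive_eq (is_cderiveD (is_cderiveM h2 h3) (is_cderiveN (is_cderiveM h1 h4))) _.
  by ring.
pose g x : R := x `^ k * expR (- x / 2).
have g0 x : 0 < x -> 0 < g x by move=> x0; rewrite mulr_gt0 ?powR_gt0 ?expR_gt0.
have nearV : \forall x \near +oo, 2^-1 <= complex.Re ((w x / (g x)%:C%C) ^- 2) /\
    2^-1 <= complex.Re (w x / (g x)%:C%C).
  have e0 : 0 < 10^-1 :> R by [].
  have /cvgrPdist_le/(_ _ e0) n1 := wlim.1.
  have /cvgrPdist_le/(_ _ e0) n2 := wlim.2.
  near=> x.
  have x0 : 0 < x by near: x; exact: nbhs_pinfty_gt.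
  have v1 : `|complex.Re (w x / (g x)%:C%C) - 1| <= 10^-1.
    by rewrite distrC; near: x; exact: n1.
  split; last by move: v1; rewrite ler_norml => /andP[]; lra.
  by apply: Re_invsqr_ge => //; rewrite -normrN -sub0r; near: x; exact: n2.
have near0 e : 0 < e -> \forall x \near +oo, normc (d x / (g x)%:C%C) <= e.
  move=> e0; have e4 : 0 < e / 4 by rewrite divr_gt0.
  have /cvgrPdist_le/(_ _ e4) n1 := wlim.1.
  have /cvgrPdist_le/(_ _ e4) n2 := wlim.2.
  have /cvgrPdist_le/(_ _ e4) n3 := ulim.1.
  have /cvgrPdist_le/(_ _ e4) n4 := ulim.2.
  have tri (p q r : R) : `|r - p| <= e / 4 -> `|r - q| <= e / 4 -> `|q - p| <= e / 2.
    move=> h1 h2; have -> : e / 2 = e / 4 + e / 4 by field.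
    by apply: le_trans (ler_distD r _ _) _; rewrite lerD// distrC.
  near=> x; apply: le_trans (normc_le_ReIm _) _.
  have r1 : `|complex.Re 1 - complex.Re (w x / (g x)%:C%C)| <= e / 4.
    by near: x; exact: n1.
  have r2 : `|complex.Im 1 - complex.Im (w x / (g x)%:C%C)| <= e / 4.
    by near: x; exact: n2.
  have r3 : `|complex.Re 1 - complex.Re (u x / (g x)%:C%C)| <= e / 4.
    by near: x; exact: n3.
  have r4 : `|complex.Im 1 - complex.Im (u x / (g x)%:C%C)| <= e / 4.
    by near: x; exact: n4.
  rewrite /d mulrBl ReD ImD ReN ImN.
  rewrite [e]splitr; apply: lerD; [exact: tri r1 r3|exact: tri r2 r4].
have [X0 [_ HX0]] := nearV; have [X1 [_ HX1]] := whittaker_weight_le1 k.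
pose X := 1 + Num.max (Num.max X0 X1) 0.
have X_gt0 : 0 < X by rewrite /X ltr_pwDl// le_max lexx orbT.
have XP x : X <= x -> [/\ 0 < x, 2^-1 <= complex.Re ((w x / (g x)%:C%C) ^- 2),
    2^-1 <= complex.Re (w x / (g x)%:C%C) & g x <= 1].
  move=> Xx; have m0 : Num.max (Num.max X0 X1) 0 < x.
    by apply: lt_le_trans Xx; rewrite /X ltrDr.
  have x0 : 0 < x by exact: lt_le_trans Xx.
  have [|h1 h2] := HX0 x.
    by apply: le_lt_trans m0; rewrite !le_max lexx.
  split => //; apply: HX1.
  by apply: le_lt_trans m0; rewrite !le_max lexx orbT.
have w_neq0 x : X <= x -> w x != 0.
  move=> /XP[_ _ h _]; apply/eqP => w0; move: h.
  by rewrite w0 mul0r /= invr_le0; lra.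
have WE x : 0 < x -> W x = W X.
  move=> x0; have [xX|/ltW xX] := leP x X.
    apply: (zero_cderivative_cst xX) => t /andP[h _]; apply: WD; exact: lt_le_trans h.
  apply/esym/(zero_cderivative_cst xX) => t /andP[h _]; apply: WD; exact: lt_le_trans h.
pose C := W X; pose rho x := d x * (w x)^-1.
have rhoD x : X <= x -> is_cderive rho x (C * w x ^- 2).
  move=> Xx; have [x0 _ _ _] := XP x Xx; have wx0 := w_neq0 x Xx.
  have [h1 h2] := dD x x0; have [h3 h4] := wD x x0.
  apply: is_cderive_eq (is_cderiveM h1 (is_cderiveV wx0 h3)) _.
  by rewrite /C -(WE x x0) /W; field.
have rho0 e : 0 < e -> \forall x \near +oo, normc (rho x) <= e.
  move=> e0; have e2 : 0 < e / 2 by rewrite divr_gt0.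
  near=> x; have Xx : X <= x by near: x; apply: nbhs_pinfty_ge; rewrite num_real.
  have [x0 _ hw _] := XP x Xx.
  have gx0 : (g x)%:C%C != 0 :> R[i] by rewrite realc_eq0 gt_eqF// g0.
  have -> : rho x = (d x / (g x)%:C%C) / (w x / (g x)%:C%C).
    by rewrite /rho; field; rewrite gx0 w_neq0.
  have hw' : 2^-1 <= normc (w x / (g x)%:C%C).
    by apply: le_trans hw _; apply: le_trans (ler_norm _) (Re_le_normc _).
  rewrite normcM normcV ler_pdivrMr; last by apply: lt_le_trans hw'.
  apply: le_trans (_ : e / 2 <= _); last by rewrite ler_wpM2l// ltW.
  by near: x; exact: near0.
have rhoX0 : C = 0 -> forall x, X <= x -> d x = 0.
  move=> C0 x Xx; have rx : rho x = 0.
    apply: eq0_normc; apply/eqP; rewrite eq_le normc_ge0 andbT.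
    apply/ler_addgt0Pr => e e0; rewrite add0r.
    have [Y [_ HY]] := rho0 e e0.
    pose y := 1 + Num.max x Y.
    have xy : x <= y by have : x <= Num.max x Y by [rewrite le_max lexx]; rewrite /y; lra.
    have <- : rho y = rho x.
      apply/esym/(zero_cderivative_cst xy) => t /andP[h _].
      by apply: is_cderive_eq (rhoD t (le_trans Xx h)) _; rewrite C0 mul0r.
    by apply: HY; have : Y <= Num.max x Y by [rewrite le_max lexx orbT]; rewrite /y; lra.
  have : rho x * w x = 0 by rewrite rx mul0r.
  by rewrite /rho mulfVK// w_neq0.
(* Otherwise the real part of [rho / C] grows at least linearly. *)
have C0 : C = 0.
  apply/eqP/negPn/negP => Cn0.
  pose sig x := C^-1 * rho x.
  have sigD x : X <= x -> is_derive x (1 : R) (fun y => complex.Re (sig y)) (complex.Re (w x ^- 2)).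
    move=> Xx; have [h _] := is_cderiveZ C^-1 (rhoD x Xx).
    by move: h; rewrite mulKf.
  have sig1 x : X <= x -> 2^-1 <= complex.Re (w x ^- 2).
    move=> Xx; have [x0 h1 _ h2] := XP x Xx; have gx := g0 x x0.
    have -> : w x ^- 2 = (g x ^- 2)%:C%C * (w x / (g x)%:C%C) ^- 2.
      rewrite realcV expr2 realcM; field.
      by rewrite w_neq0// realc_eq0 gt_eqF.
    rewrite ReM /= mul0r subr0; apply: (le_trans h1).
    rewrite ler_peMl//; first by apply: le_trans h1.
    by rewrite invf_ge1 ?exprn_gt0// expr_le1// ltW.
  have nC : 0 < normc C.
    rewrite lt_neqAle normc_ge0 andbT eq_sym; apply/eqP => /eq0_normc h.
    by rewrite h eqxx in Cn0.
  have [Y [_ HY]] := rho0 (normc C) nC.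
  pose y := 1 + Num.max (X + 2 * (2 + `|complex.Re (sig X)|)) Y.
  have y1 : X + 2 * (2 + `|complex.Re (sig X)|) <= y.
    rewrite /y; set m := X + _.
    by have : m <= Num.max m Y by [rewrite le_max lexx]; lra.
  have s0 : 0 <= `|complex.Re (sig X)| by [].
  have Xy : X <= y by lra.
  have := ge_derivative_le Xy (fun t ht => sigD t (andP ht).1) (fun t ht => sig1 t (andP ht).1).
  have : normc (rho y) <= normc C.
    apply: HY; rewrite /y; set m := X + _.
    by have : Y <= Num.max m Y by [rewrite le_max lexx orbT]; lra.
  have : complex.Re (sig y) <= normc (sig y) := le_trans (ler_norm _) (Re_le_normc _).
  rewrite /sig normcM normcV -/(sig y) -/(sig X) => h1 h2.
  have h3 : (normc C)^-1 * normc (rho y) <= 1 by rewrite mulrC ler_pdivrMr// mul1r.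
  have := ler_norm (- complex.Re (sig X)); rewrite normrN.
  move: h1; rewrite -/(sig y); lra.
move=> x x0; apply/eqP; rewrite -subr_eq0; apply/eqP; rewrite -/(d x).
have [Xx|/ltW xX] := leP X x; first exact: rhoX0.
(* Beyond [X] the difference vanishes identically, hence also its derivative;
   below [X], where [w] may have zeros, this propagates backwards. *)
pose X2 := X + 1; have X2_ge : X <= X2 by rewrite /X2 lerDl.
have xX2 : x <= X2 by apply: le_trans X2_ge.
have d1X2 : d1 X2 = 0.
  have X2_gt : X < X2 by rewrite /X2 ltrDl.
  have [h _] := dD X2 (lt_le_trans X_gt0 X2_ge).
  have hz : is_cderive d X2 0.
    apply: (@is_cderive_near _ (fun=> 0)); last exact: is_cderive_cst.
    near=> y; apply/esym/rhoX0 => //; apply: ltW; near: y; exact: lt_nbhsr.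
  by rewrite -(is_cderiveE h) (is_cderiveE hz).
apply: (@linear_ode_unique_backward d d1 Q x X2
  (`|k| / x + normc (1 / 4 : R[i]) + normc (1 / 4 - l ^+ 2) / x ^+ 2)) => //.
- by move=> t /andP[h _]; exact: (dD t (lt_le_trans x0 h)).1.
- by move=> t /andP[h _]; exact: (dD t (lt_le_trans x0 h)).2.
- move=> t /andP[h _]; have t0 := lt_le_trans x0 h; rewrite /Q.
  apply: le_trans (le_normcD _ _) _; apply: lerD.
    apply: le_trans (le_normcD _ _) _; rewrite normcN normc_real lerD2r.
    by rewrite normrM normfV (gtr0_norm t0) ler_wpM2l// lef_pV2.
  rewrite normcM normcV normc_real ger0_norm ?sqr_ge0// ler_wpM2l ?normc_ge0//.
  by rewrite lef_pV2 ?posrE ?exprn_gt0// lerXn2r// nnegrE ltW.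
- exact: rhoX0.
Unshelve. all: by end_near. Qed.

End Uniqueness.

(** * Products of confluent integrals and the Beta function *)

Section BetaIntegral.
Context {R : realType}.
Implicit Types (x s v p q : R) (a b c e : R[i]).

Definition beta_kernel b c v : R[i] := cpow v (b - 1) * cpow (1 - v) (c - 1).

Definition cBeta b c : R[i] := cintegralT (beta_kernel b c).

Lemma beta_kernel_out b c v : ~~ (0 < v < 1) -> beta_kernel b c v = 0.
Proof.
rewrite negb_and -!leNgt => /orP[v0|v1]; rewrite /beta_kernel.
  by rewrite (cpow_le0 _ v0) mul0r.
by rewrite (cpow_le0 (c - 1)) ?mulr0// subr_le0.
Qed.

Lemma cmeasurable_beta_kernel b c :
  cmeasurable (beta_kernel b c : measurableTypeR R -> R[i]).
Proof.
apply: cmeasurableM; first exact: cmeasurable_cpow.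
by apply: cmeasurable_cpow; exact: measurable_funB.
Qed.

(** [half_line_bound p v] is of the order of [v ^ (p - 1)] near the origin, so
    this sum matches the singularities of the Beta density at both endpoints. *)
Definition beta_bound p q v : R :=
  half_line_bound p v + half_line_bound q (1 - v).

Lemma beta_bound_ge0 p q v : 0 <= beta_bound p q v.
Proof. by rewrite addr_ge0// half_line_bound_ge0. Qed.

Lemma beta_bound_integrable p q : 0 < p -> 0 < q -> Rintegrable (beta_bound p q).
Proof.
move=> p0 q0; apply: RintegrableD; first exact: half_line_bound_integrable.
have N10 : -1 != 0 :> R by rewrite oppr_eq0 oner_eq0.
have := Rintegrable_affine 1 N10 (half_line_bound_integrable q0).
by under eq_fun do rewrite mulN1r.
Qed.

(** On the left half of the interval the factor in [1 - v] is bounded; the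
    right half follows by symmetry. *)
Let powR_half_bound p q v : 0 < v <= 1 / 2 -> 0 < p ->
  v `^ (p - 1) * (1 - v) `^ (q - 1) <=
  expR ((`|q - 1| + (p + 1)) * ln 2) * half_line_bound p v.
Proof.
move=> /andP[v0 v2] p0; have v1 : 0 < 1 - v by lra.
rewrite /half_line_bound v0 /powR !gt_eqF// -!expRD ler_expR.
have l1 : ln (1 + v) <= ln 2 by rewrite ler_ln ?posrE; lra.
have l2 : - ln 2 <= ln (1 - v).
  by rewrite -lnV ?posrE// ler_ln ?posrE; lra.
have l3 : ln (1 - v) <= 0 by apply: ln_le0; lra.
have l4 : (q - 1) * ln (1 - v) <= `|q - 1| * ln 2.
  apply: le_trans (ler_norm _) _; rewrite normrM ler_wpM2l// ler0_norm//; lra.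
have l5 : (p + 1) * ln (1 + v) <= (p + 1) * ln 2 by rewrite ler_wpM2l//; lra.
by rewrite mulrDl; lra.
Qed.

Lemma beta_kernel_dominated b c : 0 < complex.Re b -> 0 < complex.Re c ->
  exists2 C, 0 <= C & forall v,
    normc (beta_kernel b c v) <= C * beta_bound (complex.Re b) (complex.Re c) v.
Proof.
set p := complex.Re b; set q := complex.Re c => p0 q0.
pose C1 := expR ((`|q - 1| + (p + 1)) * ln 2).
pose C2 := expR ((`|p - 1| + (q + 1)) * ln 2).
have C10 : 0 <= C1 := expR_ge0 _; have C20 : 0 <= C2 := expR_ge0 _.
exists (C1 + C2) => [|v]; first exact: addr_ge0.
have [/andP[v0 v1]|vout] := boolP (0 < v < 1); last first.
  by rewrite beta_kernel_out// normc0 mulr_ge0 ?addr_ge0// half_line_bound_ge0.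
have v1' : 0 < 1 - v by rewrite subr_gt0.
rewrite /beta_kernel normcM !normc_cpow// !ReD !ReN -/p -/q [complex.Re _]/=.
have h1 := half_line_bound_ge0 p v; have h2 := half_line_bound_ge0 q (1 - v).
have [v2|v2] := leP v (1 / 2).
  apply: le_trans (powR_half_bound q _ p0) _; first by rewrite v0.
  rewrite -/C1 /beta_bound; apply: ler_pM => //; first by rewrite lerDl.
  by rewrite lerDl.
have h : (1 - v) `^ (q - 1) * (1 - (1 - v)) `^ (p - 1) <= C2 * half_line_bound q (1 - v).
  by apply: powR_half_bound => //; rewrite v1' /=; lra.
rewrite subKr in h; rewrite [leLHS]mulrC; apply: (le_trans h).
rewrite /beta_bound; apply: ler_pM => //; first by rewrite lerDr.
by rewrite lerDr.
Qed.

Lemma powR1D_bounded s v p : 0 <= s -> 0 <= v <= 1 ->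
  (1 + s * v) `^ p <= (1 + s) `^ `|p|.
Proof.
move=> s0 /andP[v0 v1]; have sv0 : 0 <= s * v by rewrite mulr_ge0.
apply: le_trans (_ : (1 + s * v) `^ `|p| <= _).
  by apply: ler_powR; [rewrite lerDl|exact: ler_norm].
rewrite /powR !gt_eqF ?ltr_pwDl// ler_expR ler_wpM2l// ler_ln ?posrE ?ltr_pwDl//.
by rewrite lerD2l ler_piMr.
Qed.

(** The inner integral of the convolution of two Laplace kernels, rescaled to
    the unit interval. *)
Definition beta_convolution b e c d s : R[i] := cintegralT (fun v =>
  beta_kernel b c v * (cpow (1 + s * v) e * cpow (1 + s * (1 - v)) d)).

Lemma beta_convolution_integrable b e c d s : 0 <= s ->
  0 < complex.Re b -> 0 < complex.Re c -> cintegrableT (fun v =>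
  beta_kernel b c v * (cpow (1 + s * v) e * cpow (1 + s * (1 - v)) d)).
Proof.
move=> s0 b0 c0; have [C C0 HC] := beta_kernel_dominated b0 c0.
pose M := (1 + s) `^ `|complex.Re e| * (1 + s) `^ `|complex.Re d|.
apply: (@cintegrable_dominated _ _ (fun v => (C * M) * beta_bound (complex.Re b) (complex.Re c) v)).
- apply: cmeasurableM; first exact: cmeasurable_beta_kernel.
  apply: cmeasurableM; apply: cmeasurable_cpow.
    by apply: measurable_funD => //; exact: measurable_funM.
  by apply: measurable_funD => //; apply: measurable_funM => //; exact: measurable_funB.
- move=> v; have [/andP[v0 v1]|vout] := boolP (0 < v < 1); last first.
    rewrite beta_kernel_out// mul0r normc0 mulr_ge0 ?beta_bound_ge0//.
    by rewrite mulr_ge0// mulr_ge0// powR_ge0.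
  rewrite [leRHS]mulrAC normcM; apply: ler_pM; rewrite ?normc_ge0//.
  rewrite normcM !normc_cpow ?ltr_pwDl ?mulr_ge0 ?subr_ge0 ?(ltW v0) ?(ltW v1)//.
  apply: ler_pM; rewrite ?powR_ge0// powR1D_bounded// ?(ltW v0) ?(ltW v1)//.
  by apply/andP; split; lra.
- by apply: RintegrableZ; exact: beta_bound_integrable.
Qed.

(** The product is the integral of the convolution; the substitution [t = s v]
    brings the inner integral to the unit interval. *)
Lemma laplace_integral_product x b e c d : 0 < x ->
  0 < complex.Re b -> 0 < complex.Re c ->
  cintegrableT (fun s => (expR (- (x * s)))%:C%C * cpow s (b + c - 1) *
    beta_convolution b e c d s) /\
  laplace_integral x b e * laplace_integral x c d =
  cintegralT (fun s => (expR (- (x * s)))%:C%C * cpow s (b + c - 1) *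
    beta_convolution b e c d s).
Proof.
move=> x0 b0 c0.
have [C1 C10 H1] := laplace_kernel_dominated b e x0.
have [C2 C20 H2] := laplace_kernel_dominated c d x0.
have i1 := RintegrableZ C1 (half_line_bound_integrable b0).
have i2 := RintegrableZ C2 (half_line_bound_integrable c0).
have := cfubini_convolution (cmeasurable_laplace_kernel x b e)
  (cmeasurable_laplace_kernel x c d) H1 H2 i1 i2.
have -> : (fun s => cintegralT (fun t => laplace_kernel x b e t *
     laplace_kernel x c d (s - t))) =
   fun s => (expR (- (x * s)))%:C%C * cpow s (b + c - 1) * beta_convolution b e c d s.
  apply/funext => s; have [s0|s0] := leP s 0.
    rewrite (cpow_le0 _ s0) mulr0 mul0r.
    transitivity (cintegralT (fun=> 0 : R[i])); last exact: cintegral0.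
    congr cintegralT; apply/funext => t; have [t0|t0] := leP t 0.
      by rewrite (laplace_kernel_le0 _ _ _ t0) mul0r.
    by rewrite (laplace_kernel_le0 x c d (t := s - t)) ?mulr0//; lra.
  have s00 : s^-1 != 0 by rewrite invr_eq0 gt_eqF.
  pose F v := beta_kernel b c v * (cpow (1 + s * v) e * cpow (1 + s * (1 - v)) d).
  have Fi : cintegrableT F by apply: beta_convolution_integrable => //; exact: ltW.
  rewrite /beta_convolution (cintegral_affine 0 s00 Fi) normfV (gtr0_norm s0).
  rewrite mulrA -cintegralZ; last exact: cintegrable_affine.
  congr cintegralT; apply/funext => t; rewrite add0r /F /beta_kernel /laplace_kernel.
  have -> : 1 - s^-1 * t = s^-1 * (s - t) by rewrite mulrBr mulVf// gt_eqF.
  rewrite !mulVKf ?gt_eqF// !cpowM ?invr_gt0//.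
  have -> : expR (- (x * s)) = expR (- (x * t)) * expR (- (x * (s - t))).
    by rewrite -expRD; congr expR; ring.
  have cV a' : cpow s^-1 a' = (cpow s a')^-1.
    apply: (@mulIf _ (cpow s a')); first exact: cpow_neq0.
    by rewrite -cpowM ?invr_gt0// mulVf ?gt_eqF// cpow1 mulVf// cpow_neq0.
  have -> : b + c - 1 = (b - 1) + (c - 1) + 1 by ring.
  rewrite !cV cpowD1 (cpowD s (b - 1) (c - 1)) realcM realcV.
  field.
  by apply/and3P; split; rewrite ?cpow_neq0// fmorph_eq0 gt_eqF.
by move=> [h1 h2]; split; [exact: h1|exact: h2].
Qed.

(** The product formula at [x = 1] without the factors in [1 + t]. *)
Lemma cBeta_cGamma b c : 0 < complex.Re b -> 0 < complex.Re c ->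
  cGamma b * cGamma c = cGamma (b + c) * cBeta b c.
Proof.
move=> b0 c0; have [_] := laplace_integral_product 0 0 ltr01 b0 c0.
rewrite -/(cGamma b) -/(cGamma c) => ->.
have Bi : cintegrableT (beta_kernel b c).
  have := beta_convolution_integrable 0 0 (lexx 0) b0 c0.
  by under eq_fun do rewrite !mul0r addr0 !cpow1 !mulr1.
have bc0 : 0 < complex.Re (b + c) by rewrite ReD addr_gt0.
rewrite /cGamma /laplace_integral -cintegralZr; last exact: laplace_kernel_integrable.
congr cintegralT; apply/funext => s; rewrite /laplace_kernel.
have [s0|s0] := leP s 0; first by rewrite (cpow_le0 _ s0) !mulr0 !mul0r.
rewrite cpow0 ?ltr_pwDl ?(ltW s0)// mulr1; congr (_ * _).
congr cintegralT; apply/funext => v.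
have [/andP[v0 v1]|vout] := boolP (0 < v < 1); last by rewrite beta_kernel_out// mul0r.
rewrite !cpow0 ?mulr1// ltr_pwDl ?mulr_ge0 ?(ltW s0) ?(ltW v0)//.
by rewrite subr_ge0 ltW.
Qed.

Lemma cBeta_neq0 b c : 0 < complex.Re b -> 0 < complex.Re c -> cBeta b c != 0.
Proof.
move=> b0 c0; have := cBeta_cGamma b0 c0; apply: contra_eq_neq => ->.
by rewrite mulr0 mulf_neq0// cGamma_neq0.
Qed.

Lemma pochhammerS a n : pochhammer a n.+1 = pochhammer a n * (a + n%:R).
Proof. by rewrite /pochhammer big_ord_recr. Qed.

Lemma pochhammer0 a : pochhammer a 0 = 1.
Proof. by rewrite /pochhammer big_ord0. Qed.

Lemma Re_addn_gt0 b n : 0 < complex.Re b -> 0 < complex.Re (b + n%:R).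
Proof. by move=> b0; rewrite ReD -realc_nat /= ltr_pwDl. Qed.

Lemma cGamma_addn b n : 0 < complex.Re b ->
  cGamma (b + n%:R) = pochhammer b n * cGamma b.
Proof.
move=> b0; elim: n => [|n IH]; first by rewrite addr0 pochhammer0 mul1r.
rewrite -natr1 addrA cGammaS; last exact: Re_addn_gt0.
by rewrite IH pochhammerS; ring.
Qed.

Lemma pochhammer_neq0 b n : 0 < complex.Re b -> pochhammer b n != 0.
Proof.
move=> b0; have := cGamma_neq0 (Re_addn_gt0 n b0).
by rewrite cGamma_addn// mulf_eq0 negb_or => /andP[].
Qed.

Lemma cBeta_addn b c m n : 0 < complex.Re b -> 0 < complex.Re c ->
  cBeta (b + m%:R) (c + n%:R) =
  pochhammer b m * pochhammer c n / pochhammer (b + c) (m + n) * cBeta b c.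
Proof.
move=> b0 c0; have bc0 : 0 < complex.Re (b + c) by rewrite ReD addr_gt0.
have h1 := cBeta_cGamma b0 c0.
have h2 := cBeta_cGamma (Re_addn_gt0 m b0) (Re_addn_gt0 n c0).
rewrite !cGamma_addn// in h2.
have e : b + m%:R + (c + n%:R) = b + c + (m + n)%:R by rewrite natrD; ring.
rewrite e cGamma_addn// in h2.
have g0 := cGamma_neq0 bc0; have p0 := pochhammer_neq0 (m + n) bc0.
apply: (@mulfI _ (pochhammer (b + c) (m + n) * cGamma (b + c))); first by rewrite mulf_neq0.
rewrite -h2 (_ : pochhammer b m * cGamma b * (pochhammer c n * cGamma c) =
  pochhammer b m * pochhammer c n * (cGamma b * cGamma c)); last by ring.
by rewrite h1; field.
Qed.

Lemma beta_kernel_addn b c m n v :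
  beta_kernel (b + m%:R) (c + n%:R) v =
  beta_kernel b c v * v%:C%C ^+ m * (1 - v)%:C%C ^+ n.
Proof.
rewrite /beta_kernel [b + _ - 1]addrAC [c + _ - 1]addrAC !cpowDn; ring.
Qed.

End BetaIntegral.

(** * The binomial series *)

Section BinomialSeries.
Context {R : realType}.
Implicit Types (r t w A : R) (a : R[i]).

(** The coefficient of [w ^ n] in [(1 - w) ^ (- a)]. *)
Definition binomial_coeff a n : R[i] := pochhammer a n / (n`!)%:R.

Definition binomial_partial a n w : R[i] :=
  \sum_(0 <= k < n) binomial_coeff a k * w%:C%C ^+ k.

Lemma binomial_coeff0 a : binomial_coeff a 0 = 1.
Proof. by rewrite /binomial_coeff pochhammer0 fact0 divr1. Qed.

Lemma binomial_coeffS a n :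
  n.+1%:R * binomial_coeff a n.+1 = (a + n%:R) * binomial_coeff a n.
Proof.
rewrite /binomial_coeff pochhammerS factS natrM.
field.
by rewrite nat1r !pnatr_eq0 -lt0n fact_gt0.
Qed.

Lemma binomial_coeff_shift a n :
  (a + n%:R) * binomial_coeff a n = a * binomial_coeff (a + 1) n.
Proof.
rewrite /binomial_coeff !mulrA; congr (_ / _).
elim: n => [|n IH]; first by rewrite addr0 !pochhammer0.
rewrite !pochhammerS [RHS]mulrA -IH -natr1; ring.
Qed.

Lemma binomial_coeff_real_ge0 A n : 0 <= A ->
  0 <= complex.Re (binomial_coeff A%:C%C n) /\
  complex.Im (binomial_coeff A%:C%C n) = 0.
Proof.
move=> A0; suff [c c0 ->] : exists2 c : R, 0 <= c & binomial_coeff A%:C%C n = c%:C%C by [].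
elim: n => [|n [c c0 IH]]; first by exists 1; rewrite ?binomial_coeff0.
have n0 : n.+1%:R != 0 :> R[i] by rewrite pnatr_eq0.
exists ((n.+1%:R)^-1 * ((A + n%:R) * c)).
  by rewrite mulr_ge0 ?invr_ge0// mulr_ge0// addr_ge0.
apply: (mulfI n0); rewrite binomial_coeffS IH !realcM realcV realcD !realc_nat.
by rewrite mulVKf.
Qed.

Lemma normc_nat n : normc (n%:R : R[i]) = n%:R.
Proof. by rewrite -realc_nat normc_real ger0_norm. Qed.

(** The recurrence for the coefficients compares them with those of a real
    parameter, which are nonnegative. *)
Lemma normc_binomial_coeff a A n : normc a <= A ->
  normc (binomial_coeff a n) <= complex.Re (binomial_coeff A%:C%C n).
Proof.
move=> aA; have A0 : 0 <= A := le_trans (normc_ge0 a) aA.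
elim: n => [|n IH]; first by rewrite !binomial_coeff0 normc1.
have n0 : 0 < n.+1%:R :> R by rewrite ltr0n.
rewrite -(ler_pM2l n0) -{1}normc_nat -normcM binomial_coeffS.
have -> : n.+1%:R * complex.Re (binomial_coeff A%:C%C n.+1) =
    (A + n%:R) * complex.Re (binomial_coeff A%:C%C n).
  have := congr1 (@complex.Re R) (binomial_coeffS A%:C%C n).
  by rewrite -!realc_nat -realcD !ReM /= !mul0r !subr0.
rewrite normcM; apply: ler_pM; rewrite ?normc_ge0//.
by apply: le_trans (le_normcD _ _) _; rewrite normc_nat lerD2r.
Qed.

Lemma normc_binomial_partial a A n w r : normc a <= A -> 0 <= w <= r ->
  normc (binomial_partial a n w) <= complex.Re (binomial_partial A%:C%C n r).
Proof.
move=> aA /andP[w0 wr]; have r0 : 0 <= r := le_trans w0 wr.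
rewrite /binomial_partial; elim: n => [|n IH]; first by rewrite !big_geq// normc0.
rewrite !big_nat_recr//= ReD; apply: le_trans (le_normcD _ _) _; apply: lerD => //.
rewrite normcM normcX normc_real (ger0_norm w0).
have -> : complex.Re (binomial_coeff A%:C%C n * r%:C%C ^+ n) =
    complex.Re (binomial_coeff A%:C%C n) * r ^+ n.
  by rewrite -rmorphXn ReM /= mulr0 subr0.
by apply: ler_pM; rewrite ?normc_ge0 ?exprn_ge0 ?normc_binomial_coeff// lerXn2r.
Qed.

Let derivative_sum a n w : R[i] :=
  \sum_(0 <= k < n) (a + k%:R) * binomial_coeff a k * w%:C%C ^+ k.

Let is_cderive_pow n w : is_cderive (fun y : R => y%:C%C ^+ n.+1 : R[i]) w
  (n.+1%:R * w%:C%C ^+ n).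
Proof.
have h : is_cderive (fun y : R => y%:C%C) w 1.
  by have := is_cderive_real (is_derive_id w (1 : R)).
elim: n => [|n IH].
  by under eq_fun do rewrite expr1; rewrite expr0 mulr1.
under eq_fun do rewrite exprS.
apply: is_cderive_eq (is_cderiveM h IH) _.
by rewrite -[n.+2%:R]nat1r exprS; ring.
Qed.

Let is_cderive_binomial_partial a n w :
  is_cderive (binomial_partial a n.+1) w (derivative_sum a n w).
Proof.
rewrite /derivative_sum; elim: n => [|n IH].
  rewrite big_geq//.
  have -> : binomial_partial a 1 = fun=> 1.
    by apply/funext => y; rewrite /binomial_partial big_nat1 binomial_coeff0 expr0 mulr1.
  exact: is_cderive_cst.
rewrite big_nat_recr//=.
have -> : binomial_partial a n.+2 =
    fun y => binomial_partial a n.+1 y + binomial_coeff a n.+1 * y%:C%C ^+ n.+1.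
  by apply/funext => y; rewrite /binomial_partial big_nat_recr.
apply: is_cderiveD => //.
apply: is_cderive_eq (is_cderiveZ _ (is_cderive_pow n w)) _.
by rewrite mulrA [_ * n.+1%:R]mulrC binomial_coeffS.
Qed.

(** The partial sums satisfy the differential equation of [(1 - w) ^ (- a)] up
    to a single monomial. *)
Let binomial_partial_ode a n w :
  (1 - w%:C%C) * derivative_sum a n w =
  a * binomial_partial a n.+1 w - (a + n%:R) * binomial_coeff a n * w%:C%C ^+ n.
Proof.
rewrite /derivative_sum /binomial_partial; elim: n => [|n IH].
  by rewrite big_geq// big_nat1 !addr0 mulr0 mulrA subrr.
rewrite big_nat_recr//= mulrDr IH [in RHS]big_nat_recr//=.
have h := binomial_coeffS a n.
have -> : (a + n.+1%:R) * binomial_coeff a n.+1 =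
   a * binomial_coeff a n.+1 + (a + n%:R) * binomial_coeff a n.
  by rewrite -h mulrDl.
rewrite exprS; ring.
Qed.

(** By the preceding identity all terms cancel but one. *)
Let is_cderive_binomial_ratio a n w : w < 1 ->
  is_cderive (fun y => binomial_partial a n.+1 y * cpow (1 - y) a) w
    (- (a * binomial_coeff (a + 1) n * w%:C%C ^+ n * cpow (1 - w) (a - 1))).
Proof.
move=> w1; have w1' : 0 < 1 - w by rewrite subr_gt0.
have h1 : is_cderive (fun y => cpow (1 - y) a) w (- (a * cpow (1 - w) (a - 1))).
  have hl : is_derive w (1 : R) (fun y : R => ln (1 - y)) (- (1 - w)^-1).
    have h2 : is_derive w (1 : R) (fun y : R => 1 - y) (-1).
      apply: is_derive_eq (is_deriveB (is_derive_cst (1 : R) _ _) (is_derive_id _ _)) _.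
      by rewrite sub0r.
    have h3 : is_derive (1 - w) (1 : R) (@ln R) (1 - w)^-1 := is_derive1_ln w1'.
    apply: is_derive_eq (@is_derive1_comp _ (@ln R) (fun y : R => 1 - y) w _ _ h3 h2) _.
    by rewrite mulrN1.
  apply: (@is_cderive_near _ (fun y => cexp (a * (ln (1 - y))%:C%C))).
    near=> y; rewrite cpowE// subr_gt0; near: y; exact: lt_nbhsl.
  apply: is_cderive_eq (is_cderive_cexp (is_cderiveZ a (is_cderive_real hl))) _.
  rewrite -cpowE// cpowD cpowN// cpow_powR1// realcN realcV; ring.
apply: is_cderive_eq (is_cderiveM (is_cderive_binomial_partial a n w) h1) _.
have -> : cpow (1 - w) a = (1 - w%:C%C) * cpow (1 - w) (a - 1).
  by rewrite -{1}(subrK 1 a) cpowD1 realcD realcN.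
rewrite -binomial_coeff_shift.
have h := binomial_partial_ode a n w.
rewrite mulrA [derivative_sum a n w * _]mulrC h; ring.
Unshelve. all: by end_near. Qed.

Let binomial_ratio0 a n : binomial_partial a n.+1 0 * cpow (1 - 0) a = 1.
Proof.
rewrite subr0 cpow1 mulr1 /binomial_partial big_nat_recl// binomial_coeff0 expr0 mulr1.
by rewrite big1_seq ?addr0// => k _; rewrite exprS mul0r mulr0.
Qed.

(** The quotient of the partial sum by [(1 - r) ^ (- A)] starts at 1 and has a
    nonpositive derivative. *)
Lemma binomial_partial_real_le A n r : 0 <= A -> 0 <= r < 1 ->
  complex.Re (binomial_partial A%:C%C n r) <= (1 - r) `^ (- A).
Proof.
move=> A0 /andP[r0 r1]; case: n => [|n].
  by rewrite /binomial_partial big_geq// powR_ge0.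
have r1' : 0 < 1 - r by rewrite subr_gt0.
pose f y := complex.Re (binomial_partial A%:C%C n.+1 y * cpow (1 - y) A%:C%C).
pose df y := complex.Re (- (A%:C%C * binomial_coeff (A%:C%C + 1) n * y%:C%C ^+ n *
   cpow (1 - y) (A%:C%C - 1))).
have dfE y : 0 <= y <= r -> df y <= 0.
  move=> /andP[y0 yr]; have y1 : 0 < 1 - y by lra.
  have A1 : 0 <= A + 1 by rewrite addr_ge0.
  have e1 : A%:C%C + 1 = (A + 1)%:C%C :> R[i] by rewrite realcD.
  have e2 : A%:C%C - 1 = (A - 1)%:C%C :> R[i] by rewrite realcD realcN.
  rewrite /df e1 e2.
  rewrite cpow_real// ReN oppr_le0 -rmorphXn.
  move: (binomial_coeff _ n) (binomial_coeff_real_ge0 n A1) => k [h1 h2].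
  rewrite -!mulrA -realcM.
  rewrite !ReM !ImM /= h2 !mul0r !subr0.
  by rewrite mulr_ge0// mulr_ge0// mulr_ge0 ?exprn_ge0 ?powR_ge0.
have fD y : 0 <= y <= r -> is_derive y (1 : R) (fun z => - f z) (- df y).
  move=> /andP[y0 yr]; have y1 : y < 1 := le_lt_trans yr r1.
  have [h _] := is_cderive_binomial_ratio A%:C%C n y1.
  exact: is_deriveN.
have : 0 <= - f r - - f 0.
  rewrite -[leLHS](mul0r (r - 0)); apply: (ge_derivative_le r0 fD) => y hy.
  by rewrite oppr_ge0 dfE.
rewrite /f binomial_ratio0 /= opprK addrC subr_ge0 cpow_real// ReM /= mulr0 subr0.
by rewrite -ler_pdivlMr ?powR_gt0// mul1r -powRN.
Qed.

Lemma normc_binomial_partial_le a n w r : 0 <= w <= r -> r < 1 ->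
  normc (binomial_partial a n w) <= (1 - r) `^ (- normc a).
Proof.
move=> wr r1; apply: le_trans (normc_binomial_partial n (lexx _) wr) _.
apply: binomial_partial_real_le; first exact: normc_ge0.
by move: wr => /andP[w0 wr]; rewrite (le_trans w0 wr).
Qed.

Lemma normc_binomial_coeff_le a n r : 0 <= r < 1 ->
  normc (binomial_coeff a n) * r ^+ n <= (1 - r) `^ (- normc a).
Proof.
move=> /andP[r0 r1].
apply: le_trans (_ : complex.Re (binomial_partial (normc a)%:C%C n.+1 r) <= _); last first.
  by apply: binomial_partial_real_le; rewrite ?normc_ge0// r0.
rewrite /binomial_partial big_nat_recr//= ReD.
have -> : complex.Re (binomial_coeff (normc a)%:C%C n * r%:C%C ^+ n) =
    complex.Re (binomial_coeff (normc a)%:C%C n) * r ^+ n.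
  by rewrite -rmorphXn ReM /= mulr0 subr0.
apply: le_trans (_ : complex.Re (binomial_coeff (normc a)%:C%C n) * r ^+ n <= _).
  by rewrite ler_wpM2r ?exprn_ge0// normc_binomial_coeff.
rewrite lerDr; apply: le_trans (normc_ge0 _) (@normc_binomial_partial a _ n r r (lexx _) _).
by rewrite lexx r0.
Qed.

Lemma derivative_bound (f df : R -> R) (x y B : R) : x <= y ->
  (forall t, x <= t <= y -> is_derive t (1 : R) f (df t)) ->
  (forall t, x <= t <= y -> `|df t| <= B) -> `|f y - f x| <= B * (y - x).
Proof.
move=> xy fd dB.
have h1 : - B * (y - x) <= f y - f x.
  apply: (ge_derivative_le xy fd) => t ht.
  by have := dB t ht; rewrite ler_norml => /andP[].
have h2 : - B * (y - x) <= - f y - - f x.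
  apply: (@ge_derivative_le _ (fun t => - f t) (fun t => - df t) _ _ _ xy) => t ht.
    exact: is_deriveN (fd t ht).
  by have := dB t ht; rewrite ler_norml lerN2 => /andP[].
by rewrite mulNr in h1 h2; rewrite ler_norml; apply/andP; split; lra.
Qed.

(** The partial sum multiplied by [(1 - w) ^ a] is 1 at the origin, and its
    derivative decays geometrically in [n], uniformly between 0 and [w]. *)
Lemma binomial_series a w : 0 <= w < 1 ->
  ccvg (fun n => binomial_partial a n w) (cpow (1 - w) (- a)).
Proof.
move=> /andP[w0 w1]; have w1' : 0 < 1 - w by rewrite subr_gt0.
pose h n y := binomial_partial a n.+1 y * cpow (1 - y) a.
pose dh n y := - (a * binomial_coeff (a + 1) n * y%:C%C ^+ n * cpow (1 - y) (a - 1)).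
(* The coefficients are bounded by multiples of [r ^ (- n)] for any [r < 1];
   taking [r] above [w] leaves the ratio [w / r]. *)
pose r := (1 + w) / 2.
have r0 : 0 < r by rewrite divr_gt0// ltr_pwDl.
have r1 : r < 1 by rewrite /r; lra.
have wr : w < r by rewrite /r; lra.
pose q := w / r.
have q0 : 0 <= q by rewrite divr_ge0// ltW.
have q1 : q < 1 by rewrite ltr_pdivrMr// mul1r.
pose K := normc a * (1 - r) `^ (- normc (a + 1)) * (1 - w) `^ (- `|complex.Re a - 1|).
have dhB n t : 0 <= t <= w -> normc (dh n t) <= K * q ^+ n.
  move=> /andP[t0 tw]; have t1 : 0 < 1 - t by lra.
  rewrite /dh normcN 3!normcM normcX normc_real (ger0_norm t0) normc_cpow//.
  have b1 : normc (binomial_coeff (a + 1) n) * t ^+ n <=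
      (1 - r) `^ (- normc (a + 1)) * q ^+ n.
    have b0 := normc_binomial_coeff_le (a + 1) n (_ : 0 <= r < 1).
    rewrite /q expr_div_n mulrA ler_pdivlMr ?exprn_gt0//.
    rewrite mulrAC; apply: ler_pM; rewrite ?mulr_ge0 ?normc_ge0 ?exprn_ge0 ?(ltW r0)//.
      by apply: b0; rewrite (ltW r0).
    by rewrite lerXn2r ?nnegrE.
  have b2 : (1 - t) `^ complex.Re (a - 1) <= (1 - w) `^ (- `|complex.Re a - 1|).
    rewrite ReD ReN [complex.Re 1]/= /powR !gt_eqF// ler_expR.
    have l1 : ln (1 - w) <= ln (1 - t) by rewrite ler_ln ?posrE//; lra.
    have l2 : ln (1 - t) <= 0 by apply: ln_le0; lra.
    apply: le_trans (ler_norm _) _; rewrite normrM mulNr -mulrN ler_wpM2l//.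
    by rewrite ler0_norm// lerN2.
  have -> : K * q ^+ n = normc a * ((1 - r) `^ (- normc (a + 1)) * q ^+ n) *
      (1 - w) `^ (- `|complex.Re a - 1|) by rewrite /K; ring.
  rewrite -[normc a * _ * _]mulrA; apply: ler_pM => //.
  - by rewrite !mulr_ge0 ?normc_ge0 ?exprn_ge0.
  - exact: powR_ge0.
  - by rewrite ler_wpM2l ?normc_ge0.
have hD n t : 0 <= t <= w -> is_cderive (h n) t (dh n t).
  move=> /andP[_ tw]; apply: is_cderive_binomial_ratio; exact: le_lt_trans w1.
have cq : K * q ^+ n * (w - 0) @[n --> \oo] --> (0 : R).
  rewrite [X in _ --> X](_ : 0 = K * 0 * (w - 0)); last by rewrite mulr0 mul0r.
  apply: cvgM; last exact: cvg_cst.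
  by apply: cvgM; [exact: cvg_cst|apply: cvg_expr; rewrite ger0_norm].
have h0 n : h n 0 = 1 := binomial_ratio0 a n.
have h1 : ccvg (fun n => h n w) 1.
  split; apply/subr_cvg0; apply: norm_cvg0; apply: squeeze_cvgr (cvg_cst 0) cq; apply: nearW => n;
    rewrite normr_ge0 andTb -(h0 n).
    apply: (@derivative_bound (fun y => complex.Re (h n y))
      (fun y => complex.Re (dh n y)) _ _ _ w0) => t ht; first exact: (hD n t ht).1.
    exact: le_trans (Re_le_normc _) (dhB n t ht).
  apply: (@derivative_bound (fun y => complex.Im (h n y))
    (fun y => complex.Im (dh n y)) _ _ _ w0) => t ht; first exact: (hD n t ht).2.
  exact: le_trans (Im_le_normc _) (dhB n t ht).
have h2 : ccvg (fun n => binomial_partial a n.+1 w) (cpow (1 - w) (- a)).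
  have := ccvgM h1 (ccvg_cst (cpow (1 - w) (- a))); rewrite mul1r.
  have -> // : (fun n => h n w * cpow (1 - w) (- a)) = fun n => binomial_partial a n.+1 w.
  by apply/funext => n; rewrite /h cpowN// mulfK// cpow_neq0.
by split; rewrite -cvg_shiftS; [exact: h2.1|exact: h2.2].
Qed.

End BinomialSeries.

(** * Integral representation of the Appell series *)

Section AppellSeries.
Context {R : realType}.
Implicit Types (z v : R) (a b c : R[i]).

Lemma cseries_sumE (u : nat -> R[i]) (l : R[i]) :
  ccvg (fun n => \sum_(0 <= k < n) u k) l -> cseries_sum u = l.
Proof.
move=> [h1 h2]; apply: complexP; rewrite /cseries_sum /=; apply: cvg_lim => //.
  by move: h1; under eq_fun do rewrite Re_sum.
by move: h2; under eq_fun do rewrite Im_sum.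
Qed.

Lemma cintegral_sum n (u : nat -> R -> R[i]) : (forall k, cintegrableT (u k)) ->
  cintegrableT (fun t => \sum_(0 <= k < n) u k t) /\
  cintegralT (fun t => \sum_(0 <= k < n) u k t) = \sum_(0 <= k < n) cintegralT (u k).
Proof.
move=> ui; elim: n => [|n [IH1 IH2]].
  rewrite big_geq//; under eq_fun do rewrite big_geq//.
  split; last exact: cintegral0.
  by split; exact: integrable0.
rewrite big_nat_recr//= -IH2; under eq_fun do rewrite big_nat_recr//=.
by split; [exact: cintegrableD|exact: cintegralD].
Qed.

(** The partial sums of the binomial series are bounded uniformly between 0
    and [z], so dominated convergence applies. The first conclusion is the majorant
    needed to expand a second factor. *)
Lemma binomial_under_integral (f : R -> R[i]) (g y : R -> R) a z :
  0 <= z < 1 -> cmeasurable (f : measurableTypeR R -> R[i]) ->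
  measurable_fun (setT : set (measurableTypeR R)) y ->
  (forall v, normc (f v) <= g v) -> Rintegrable g ->
  (forall v, f v = 0 \/ 0 <= y v <= 1) ->
  (forall v, normc (f v * cpow (1 - z * y v) (- a)) <= (1 - z) `^ (- normc a) * g v) /\
  ccvg (fun n => \sum_(0 <= k < n)
      cintegralT (fun v => f v * (binomial_coeff a k * (z * y v)%:C%C ^+ k)))
    (cintegralT (fun v => f v * cpow (1 - z * y v) (- a))).
Proof.
move=> /andP[z0 z1] mf my fg gi fy; have z1' : 0 < 1 - z by rewrite subr_gt0.
have zy v : 0 <= y v <= 1 -> 0 <= z * y v <= z.
  by move=> /andP[y0 y1]; rewrite mulr_ge0//= ler_piMr.
pose M := (1 - z) `^ (- normc a).
have M0 : 0 <= M by exact: powR_ge0.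
have g0 v : 0 <= g v := le_trans (normc_ge0 _) (fg v).
split=> [v|].
  have [->|yv] := fy v; first by rewrite mul0r normc0 mulr_ge0.
  have /andP[w0 w1] := zy v yv.
  have w1' : 0 < 1 - z * y v by lra.
  rewrite normcM mulrC; apply: ler_pM; rewrite ?normc_ge0//.
  rewrite normc_cpow// ReN /M /powR !gt_eqF// ler_expR !mulNr lerN2.
  have l1 : ln (1 - z) <= ln (1 - z * y v) by rewrite ler_ln ?posrE//; lra.
  have l2 : ln (1 - z * y v) <= 0 by apply: ln_le0; lra.
  have r1 := le_trans (ler_norm (complex.Re a)) (Re_le_normc a).
  have n0 := normc_ge0 a.
  by apply: le_trans (ler_wnM2r l2 r1); rewrite ler_wpM2l.
have mz : measurable_fun (setT : set (measurableTypeR R)) (fun v => z * y v).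
  exact: measurable_funM.
have mt k : cmeasurable (fun v : measurableTypeR R =>
    f v * (binomial_coeff a k * (z * y v)%:C%C ^+ k)).
  apply: cmeasurableM => //; apply: cmeasurableM; first exact: cmeasurable_cst.
  by apply: cmeasurableX; exact: cmeasurable_real.
have ti k : cintegrableT (fun v => f v * (binomial_coeff a k * (z * y v)%:C%C ^+ k)).
  apply: (cintegrable_dominated (mt k) (g := fun v => normc (binomial_coeff a k) * g v)); last exact: RintegrableZ.
  move=> v; have [->|yv] := fy v; first by rewrite mul0r normc0 mulr_ge0// normc_ge0.
  have /andP[w0 w1] := zy v yv.
  rewrite normcM mulrC; apply: ler_pM; rewrite ?normc_ge0//.
  rewrite (normcM (binomial_coeff a k)) normcX normc_real (ger0_norm w0).
  rewrite ler_piMr ?normc_ge0// exprn_ile1//; lra.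
have sumE v n : \sum_(0 <= k < n) f v * (binomial_coeff a k * (z * y v)%:C%C ^+ k) =
    f v * binomial_partial a n (z * y v).
  by rewrite /binomial_partial big_distrr.
have mp n : cmeasurable (fun v : measurableTypeR R => f v * binomial_partial a n (z * y v)).
  under eq_fun do rewrite -sumE; exact: cmeasurable_sum.
have cv v : ccvg (fun n => f v * binomial_partial a n (z * y v))
    (f v * cpow (1 - z * y v) (- a)).
  have [->|yv] := fy v.
    by rewrite mul0r; under eq_fun do rewrite mul0r; exact: ccvg_cst.
  have /andP[w0 w1] := zy v yv.
  by apply: ccvgM; [exact: ccvg_cst|apply: binomial_series; rewrite w0 /=; lra].
have dom n v : normc (f v * binomial_partial a n (z * y v)) <= M * g v.
  have [->|yv] := fy v; first by rewrite mul0r normc0 mulr_ge0.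
  rewrite normcM mulrC; apply: ler_pM; rewrite ?normc_ge0//.
  by apply: normc_binomial_partial_le z1; exact: zy.
have [_] := cdominated_convergence mp cv (RintegrableZ M gi) dom.
have -> // : (fun n => cintegralT (fun v => f v * binomial_partial a n (z * y v))) =
  fun n => \sum_(0 <= k < n)
    cintegralT (fun v => f v * (binomial_coeff a k * (z * y v)%:C%C ^+ k)).
apply/funext => n; have [_ <-] := cintegral_sum n ti.
by congr cintegralT; apply/funext => v; rewrite sumE.
Qed.

(** The double series of [F_3], integrated term by term against the beta
    density: each monomial produces one ratio of Pochhammer symbols. *)
Lemma appellF3_beta a a' b c z : 0 <= z < 1 ->
  0 < complex.Re b -> 0 < complex.Re c ->
  appellF3 a a' b c (b + c) z%:C%C z%:C%C * cBeta b c =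
  cintegralT (fun v => beta_kernel b c v * cpow (1 - z * (1 - v)) (- a') *
    cpow (1 - z * v) (- a)).
Proof.
move=> z01 b0 c0; have B0 := cBeta_neq0 b0 c0.
have [C C0 HC] := beta_kernel_dominated b0 c0.
pose g v := C * beta_bound (complex.Re b) (complex.Re c) v.
have gi : Rintegrable g by apply: RintegrableZ; exact: beta_bound_integrable.
have g0 v : 0 <= g v by rewrite mulr_ge0// beta_bound_ge0.
have /andP[z0 z1] := z01.
have m1 : measurable_fun (setT : set (measurableTypeR R)) (fun v : R => 1 - v).
  exact: measurable_funB.
have m2 : measurable_fun (setT : set (measurableTypeR R)) (fun v : R => v) by [].
have supp v : beta_kernel b c v = 0 \/ 0 <= v <= 1.
  have [/andP[v0 v1]|vout] := boolP (0 < v < 1); last by left; exact: beta_kernel_out.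
  by right; rewrite !ltW.
have supp1 v : beta_kernel b c v = 0 \/ 0 <= 1 - v <= 1.
  have [->|/andP[v0 v1]] := supp v; first by left.
  by right; apply/andP; split; lra.
pose W m v := beta_kernel b c v * (binomial_coeff a m * (z * v)%:C%C ^+ m).
have mW m : cmeasurable (W m : measurableTypeR R -> R[i]).
  apply: cmeasurableM; first exact: cmeasurable_beta_kernel.
  apply: cmeasurableM; first exact: cmeasurable_cst.
  by apply: cmeasurableX; apply: cmeasurable_real; exact: measurable_funM.
have Wg m v : normc (W m v) <= normc (binomial_coeff a m) * g v.
  rewrite /W; have [->|/andP[v0 v1]] := supp v.
    by rewrite mul0r normc0 mulr_ge0// normc_ge0.
  rewrite normcM mulrC; apply: ler_pM; rewrite ?normc_ge0//.
  rewrite (normcM (binomial_coeff a m)) normcX normc_real ger0_norm ?mulr_ge0//.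
  rewrite ler_piMr ?normc_ge0// exprn_ile1 ?mulr_ge0//.
  by rewrite mulr_ile1// ltW.
have Wi m := RintegrableZ (normc (binomial_coeff a m)) gi.
have Wsupp m v : W m v = 0 \/ 0 <= 1 - v <= 1.
  by have [h|h] := supp1 v; [left; rewrite /W h mul0r|right].
have inner m := binomial_under_integral a' z01 (mW m) m1 (Wg m) (Wi m) (Wsupp m).
have termE m n : appellF3_term a a' b c (b + c) z%:C%C z%:C%C m n =
    cintegralT (fun v => W m v * (binomial_coeff a' n * (z * (1 - v))%:C%C ^+ n)) *
    (cBeta b c)^-1.
  have bi : cintegrableT (beta_kernel (b + m%:R) (c + n%:R)).
    have [C' _ HC'] := beta_kernel_dominated (Re_addn_gt0 m b0) (Re_addn_gt0 n c0).
    apply: cintegrable_dominated HC' _; first exact: cmeasurable_beta_kernel.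
    by apply: RintegrableZ; apply: beta_bound_integrable; exact: Re_addn_gt0.
  have -> : (fun v => W m v * (binomial_coeff a' n * (z * (1 - v))%:C%C ^+ n)) =
     fun v => (binomial_coeff a m * binomial_coeff a' n * z%:C%C ^+ m * z%:C%C ^+ n) *
       beta_kernel (b + m%:R) (c + n%:R) v.
    by apply/funext => v; rewrite /W beta_kernel_addn !realcM !exprMn; ring.
  rewrite cintegralZ// -/(cBeta _ _) cBeta_addn//.
  rewrite /appellF3_term /binomial_coeff.
  have bc0 : 0 < complex.Re (b + c) by rewrite ReD addr_gt0.
  have p0 := pochhammer_neq0 (m + n) bc0.
  field.
  by rewrite B0 p0 !pnatr_eq0 -!lt0n !fact_gt0.
have innerE m : cseries_sum (fun n => appellF3_term a a' b c (b + c) z%:C%C z%:C%C m n) =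
    cintegralT (fun v => W m v * cpow (1 - z * (1 - v)) (- a')) * (cBeta b c)^-1.
  apply: cseries_sumE; have := ccvgM (inner m).2 (ccvg_cst (cBeta b c)^-1).
  under eq_fun do rewrite big_distrl /=.
  by under eq_fun do under eq_bigr do rewrite -termE.
pose V v := beta_kernel b c v * cpow (1 - z * (1 - v)) (- a').
have [Vg _] := binomial_under_integral a' z01 (cmeasurable_beta_kernel b c) m1 HC gi supp1.
have mV : cmeasurable (V : measurableTypeR R -> R[i]).
  apply: cmeasurableM; first exact: cmeasurable_beta_kernel.
  by apply: cmeasurable_cpow; apply: measurable_funB => //; exact: measurable_funM.
have Vsupp v : V v = 0 \/ 0 <= v <= 1.
  by have [h|h] := supp v; [left; rewrite /V h mul0r|right].
have [_ outer] := binomial_under_integral a z01 mV m2 Vg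
  (RintegrableZ ((1 - z) `^ (- normc a')) gi) Vsupp.
have -> : appellF3 a a' b c (b + c) z%:C%C z%:C%C =
    cintegralT (fun v => V v * cpow (1 - z * v) (- a)) * (cBeta b c)^-1.
  rewrite /appellF3; apply: cseries_sumE.
  have := ccvgM outer (ccvg_cst (cBeta b c)^-1).
  under eq_fun do rewrite big_distrl /=.
  under [X in _ -> ccvg X _]eq_fun do under eq_bigr do rewrite innerE.
  have WV m v : W m v * cpow (1 - z * (1 - v)) (- a') =
      V v * (binomial_coeff a m * (z * v)%:C%C ^+ m) by rewrite /W /V; ring.
  by under [X in _ -> ccvg X _]eq_fun do
    under eq_bigr do under [X in cintegralT X]eq_fun do rewrite WV.
by rewrite mulfVK.
Qed.

End AppellSeries.

(** * The product formula *)

Section ProductFormula.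
Context {R : realType}.
Implicit Types (s x : R).

Lemma whittakerW_integral (k : R) (l : R[i]) x : 0 < x ->
  0 < complex.Re (1 / 2 + l - k%:C%C) ->
  whittakerW k l x = (cGamma (1 / 2 + l - k%:C%C))^-1 * whittaker_integral k l x.
Proof.
move=> x0 b0; have h := whittaker_integral_is_whittakerW b0.
(* The chosen function is a solution because one exists. *)
have hW : is_whittakerW k l (whittakerW k l).
  by apply: (@xgetPex _ (fun=> 0) [set u | is_whittakerW k l u]); eexists; exact: h.
exact: (is_whittakerW_unique hW h x0).
Qed.

(** With [z = s / (1 + s)], [1 + s v = (1 + s) (1 - z (1 - v))]. *)
Lemma beta_convolution_appellF3 (a a' b c : R[i]) s : 0 <= s ->
  0 < complex.Re b -> 0 < complex.Re c ->
  beta_convolution b (- a') c (- a) s =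
  cpow (1 + s) (- a - a') *
  (appellF3 a a' b c (b + c) (s / (1 + s))%:C%C (s / (1 + s))%:C%C * cBeta b c).
Proof.
move=> s0 b0 c0; have s1 : 0 < 1 + s by rewrite ltr_pwDl.
have s1n : 1 + s != 0 by rewrite gt_eqF.
have z01 : 0 <= s / (1 + s) < 1.
  by rewrite divr_ge0 ?(ltW s1)//= ltr_pdivrMr// mul1r ltrDr.
have p0 : cpow (1 + s) (- a - a') != 0 by exact: cpow_neq0.
rewrite (appellF3_beta _ _ z01 b0 c0).
have -> : (fun v => beta_kernel b c v * cpow (1 - s / (1 + s) * (1 - v)) (- a') *
    cpow (1 - s / (1 + s) * v) (- a)) =
  fun v => (cpow (1 + s) (- a - a'))^-1 *
    (beta_kernel b c v * (cpow (1 + s * v) (- a') * cpow (1 + s * (1 - v)) (- a))).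
  apply/funext => v.
  have -> : 1 + s * v = (1 + s) * (1 - s / (1 + s) * (1 - v)) by field.
  have -> : 1 + s * (1 - v) = (1 + s) * (1 - s / (1 + s) * v) by field.
  rewrite (cpowM _ (- a') s1) (cpowM _ (- a) s1) (cpowD (1 + s)).
  by field; rewrite !cpow_neq0.
rewrite cintegralZ; last exact: beta_convolution_integrable.
by rewrite mulVKf.
Qed.

(** The functions built from [cpow] vanish on the nonpositive reals, whereas
    the integrand of the theorem need not. *)
Lemma cintegral_half_line (f g : R -> R[i]) :
  (forall s, 0 < s -> f s = g s) -> (forall s, s <= 0 -> g s = 0) ->
  (cintegrableT g -> cintegrable `]0, +oo[ f) /\
  cintegral `]0, +oo[ f = cintegralT g.
Proof.
move=> fg g0.
have E (h : R[i] -> R) : h 0 = 0 ->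
    ((fun s => h (f s)) \_ `]0, +oo[) = fun s => h (g s).
  move=> h0; apply/funext => s; rewrite patchE.
  case: ifPn => [|/negP]; rewrite inE /= in_itv /= andbT; first by move=> /fg ->.
  by move=> /negP; rewrite -leNgt => /g0 ->.
split; last first.
  apply: complexP; rewrite /cintegralT /cintegral /= Rintegral_mkcond.
    by rewrite (E (@complex.Re R)).
  by rewrite (E (@complex.Im R)).
have mI : measurable (`]0, +oo[%classic : set (measurableTypeR R)) := measurable_itv _.
move=> [i1 i2]; split.
  apply: (@integrable_mkcond _ _ _ lebesgue_measure _ (fun t => (complex.Re (f t))%:E) mI).2.
  by rewrite restrict_EFin (E (@complex.Re R)).
apply: (@integrable_mkcond _ _ _ lebesgue_measure _ (fun t => (complex.Im (f t))%:E) mI).2.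
by rewrite restrict_EFin (E (@complex.Im R)).
Qed.

End ProductFormula.

Theorem mainTheorem4 (R : realType) (alpha beta mu nu tau x : R)
    (hx : 0 < x) (hmu : mu + 1 / 2 > alpha) (hnu : nu + 1 / 2 > beta) :
  let itau : R[i] := ('i * tau%:C)%C in
  let F3 (s : R) : R[i] :=
    appellF3 (1 / 2 - nu%:C%C - itau - beta%:C%C)
             (1 / 2 - mu%:C%C + itau - alpha%:C%C)
             (1 / 2 + mu%:C%C - itau - alpha%:C%C)
             (1 / 2 + nu%:C%C + itau - beta%:C%C)
             (mu + nu - alpha - beta + 1)%:C%C
             (s / (1 + s))%:C%C (s / (1 + s))%:C%C in
  let integrand (s : R) : R[i] :=
    (expR (- (x * s)) * s `^ (mu + nu - alpha - beta)
       * (1 + s) `^ (nu + mu + beta + alpha - 1))%:C%C * F3 s in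
  cintegrable `]0, +oo[ integrand /\
  whittakerW alpha (mu%:C%C - itau) x * whittakerW beta (nu%:C%C + itau) x =
    (expR (- x) * x `^ (mu + nu + 1)
       / Gamma (mu + nu - alpha - beta + 1))%:C%C
    * cintegral `]0, +oo[ integrand.
Proof.
move=> itau F3 integrand.
pose b : R[i] := 1 / 2 + (mu%:C%C - itau) - alpha%:C%C.
pose c : R[i] := 1 / 2 + (nu%:C%C + itau) - beta%:C%C.
(* [- a'] and [- a] are the exponents of [1 + t] in the Euler integrals of the
   first and of the second factor. *)
pose a : R[i] := 1 / 2 - nu%:C%C - itau - beta%:C%C.
pose a' : R[i] := 1 / 2 - mu%:C%C + itau - alpha%:C%C.
have Re_itau : complex.Re itau = 0 by rewrite ReM /= mul0r mulr0 subr0.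
have halfE : 1 / 2 = (1 / 2)%:C%C :> R[i] by rewrite realcM realcV realc_nat.
have b0 : 0 < complex.Re b.
  by rewrite /b halfE !ReD !ReN Re_itau [complex.Re _%:C%C]/= /=; lra.
have c0 : 0 < complex.Re c.
  by rewrite /c halfE !ReD !ReN Re_itau /=; lra.
have bcE : b + c = (mu + nu - alpha - beta + 1)%:C%C.
  by rewrite !realcD !realcN /b /c; field.
have B0 := cBeta_neq0 b0 c0.
have g1 := cGamma_neq0 b0; have g2 := cGamma_neq0 c0.
pose w s := (expR (- (x * s)))%:C%C * cpow s (b + c - 1) *
  beta_convolution b (- a') c (- a) s.
have [wi wE] := laplace_integral_product (- a') (- a) hx b0 c0.
have fw s : 0 < s -> integrand s = (cBeta b c)^-1 * w s.
  move=> s0; have s1 : 0 < 1 + s by rewrite ltr_pwDl// ltW.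
  rewrite /w beta_convolution_appellF3 ?(ltW s0)//.
  rewrite (_ : b + c - 1 = (mu + nu - alpha - beta)%:C%C); last first.
    by rewrite bcE !realcD !realcN addrK.
  rewrite (_ : - a - a' = (nu + mu + beta + alpha - 1)%:C%C); last first.
    by rewrite !realcD !realcN /a /a'; field.
  rewrite !cpow_real// /integrand /F3 -/a -/a' -bcE !realcM.
  rewrite (_ : 1 / 2 + mu%:C%C - itau - alpha%:C%C = b); last by rewrite /b addrA.
  rewrite (_ : 1 / 2 + nu%:C%C + itau - beta%:C%C = c); last by rewrite /c addrA.
  by field.
have w0 s : s <= 0 -> (cBeta b c)^-1 * w s = 0.
  by move=> s0; rewrite /w (cpow_le0 _ s0) mulr0 mul0r mulr0.
have [hi ->] := cintegral_half_line fw w0.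
split; first by apply: hi; exact: cintegrableZ.
rewrite (cintegralZ _ wi) -wE !whittakerW_integral// -/b -/c.
rewrite /whittaker_integral -/b -/c.
rewrite (_ : mu%:C%C - itau - 1 / 2 + alpha%:C%C = - a'); last by rewrite /a'; ring.
rewrite (_ : nu%:C%C + itau - 1 / 2 + beta%:C%C = - a); last by rewrite /a; ring.
have xE : cpow x (mu%:C%C - itau + 1 / 2) * cpow x (nu%:C%C + itau + 1 / 2) =
    (x `^ (mu + nu + 1))%:C%C.
  by rewrite -cpowD -cpow_real// !realcD; congr cpow; field.
have eE : (expR (- x / 2))%:C%C * (expR (- x / 2))%:C%C = (expR (- x))%:C%C :> R[i].
  by rewrite -realcM -expRD; congr ((expR _)%:C%C); field.
have gE : (Gamma (mu + nu - alpha - beta + 1))%:C%C = cGamma b * cGamma c / cBeta b c.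
  by rewrite -cGamma_real -bcE cBeta_cGamma// mulfK.
rewrite !realcM realcV gE -xE -eE.
by field; rewrite B0 g1 g2.
Qed.
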